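(* For the 2-Set Subset-Sum Ratio problem with $n$ pairs and for every $\varepsilon\in(0,1)$, a feasible solution whose ratio is at most $(1+\varepsilon)$ times the optimal ratio can be found in time $\mathcal{O}(n^4/\varepsilon)$.
   Context: 2-Set Subset-Sum Ratio: given pairs $(a_1,b_1),\ldots,(a_n,b_n)$ of positive real numbers, find two nonempty disjoint sets $S_1,S_2\subseteq\{1,\ldots,n\}$ minimizing $\frac{\max\{\sum_{i\in S_1}a_i,\sum_{j\in S_2}b_j\}}{\min\{\sum_{i\in S_1}a_i,\sum_{j\in S_2}b_j\}}$. *)

(* Defs.v *)
From HB Require Import structures.
From mathcomp Require Import all_boot all_order all_algebra.
From mathcomp Require Import reals.

Set Implicit Arguments.
Unset Strict Implicit.
Unset Printing Implicit Defensive.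

Import Order.TTheory GRing.Theory Num.Theory.
Local Open Scope ring_scope.

(** * 2-Set Subset-Sum Ratio *)

Section Problem.
Variables (R : realType) (n : nat) (a b : 'I_n -> R).
Implicit Types S T : {set 'I_n}.

Definition feasible S1 S2 : Prop :=
  [/\ S1 != set0, S2 != set0 & [disjoint S1 & S2]].

Definition ssr_ratio S1 S2 : R :=
  Num.max (\sum_(i in S1) a i) (\sum_(j in S2) b j) /
  Num.min (\sum_(i in S1) a i) (\sum_(j in S2) b j).

Definition optimal T1 T2 : Prop :=
  feasible T1 T2 /\
  forall S1 S2, feasible S1 S2 -> ssr_ratio T1 T2 <= ssr_ratio S1 S2.

End Problem.

(** * Real RAM

   Structured programs over a unit-cost real RAM.  The memory consists of
   integer arrays and real arrays, all infinite; an array is named by a literal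
   of the program, and the cells of an array are addressed by computed
   integers.  A scalar variable is a cell with a constant address.

   Integers support addition and truncated subtraction, but not multiplication;
   reals support the field operations and comparison; an integer can be cast to
   a real, but there is no rounding and no other way to turn a real into an
   integer than branching on comparisons.  Unit-cost rounding, or unit-cost
   multiplication and division of unbounded integers, would make the machine
   unreasonably powerful.  The only literals are natural numbers. *)

Inductive nexp : Type :=
  | NLit of nat
  | NGet of nat & nexp              (* array name, address *)
  | NAdd of nexp & nexp
  | NSub of nexp & nexp.

Inductive rexp : Type :=
  | RCast of nexp
  | RGet of nat & nexp              (* array name, address *)
  | RAdd of rexp & rexp
  | RSub of rexp & rexp
  | RMul of rexp & rexp
  | RDiv of rexp & rexp.

Inductive bexp : Type :=
  | BNle of nexp & nexp
  | BRle of rexp & rexp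
  | BNot of bexp
  | BAnd of bexp & bexp.

Inductive com : Type :=
  | Skip
  | NSet of nat & nexp & nexp       (* array name, address, value *)
  | RSet of nat & nexp & rexp       (* array name, address, value *)
  | Seq of com & com
  | If of bexp & com & com
  | While of bexp & com.

(* Every literal, memory access, operation and comparison costs one step. *)

Fixpoint ncost (e : nexp) : nat :=
  match e with
  | NLit _ => 1
  | NGet _ i => (ncost i).+1
  | NAdd e1 e2 | NSub e1 e2 => (ncost e1 + ncost e2).+1
  end.

Fixpoint rcost (e : rexp) : nat :=
  match e with
  | RCast i | RGet _ i => (ncost i).+1
  | RAdd e1 e2 | RSub e1 e2 | RMul e1 e2 | RDiv e1 e2 =>
      (rcost e1 + rcost e2).+1
  end.

Fixpoint bcost (e : bexp) : nat :=
  match e with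
  | BNle e1 e2 => (ncost e1 + ncost e2).+1
  | BRle e1 e2 => (rcost e1 + rcost e2).+1
  | BNot e1 => (bcost e1).+1
  | BAnd e1 e2 => (bcost e1 + bcost e2).+1
  end.

Definition upd (V : Type) (m : nat -> nat -> V) (x i : nat) (v : V) :
    nat -> nat -> V :=
  fun y j => if (y == x) && (j == i) then v else m y j.

Section Semantics.
Variable R : realType.

Record state : Type := State {
  nmem : nat -> nat -> nat;
  rmem : nat -> nat -> R }.

Implicit Type s : state.

Fixpoint neval s (e : nexp) : nat :=
  match e with
  | NLit k => k
  | NGet x i => nmem s x (neval s i)
  | NAdd e1 e2 => (neval s e1 + neval s e2)%N
  | NSub e1 e2 => (neval s e1 - neval s e2)%N
  end.

(* Division by zero yields zero. *)
Fixpoint reval s (e : rexp) : R :=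
  match e with
  | RCast i => (neval s i)%:R
  | RGet x i => rmem s x (neval s i)
  | RAdd e1 e2 => reval s e1 + reval s e2
  | RSub e1 e2 => reval s e1 - reval s e2
  | RMul e1 e2 => reval s e1 * reval s e2
  | RDiv e1 e2 => reval s e1 / reval s e2
  end.

Fixpoint beval s (e : bexp) : bool :=
  match e with
  | BNle e1 e2 => (neval s e1 <= neval s e2)%N
  | BRle e1 e2 => reval s e1 <= reval s e2
  | BNot e1 => ~~ beval s e1
  | BAnd e1 e2 => beval s e1 && beval s e2
  end.

(* [exec c s t s']: started in [s], the program [c] halts in [s'] after exactly
   [t] steps. *)
Inductive exec : com -> state -> nat -> state -> Prop :=
  | exec_skip s : exec Skip s 1 s
  | exec_nset s x i e :
      exec (NSet x i e) s (ncost i + ncost e).+1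
           (State (upd (nmem s) x (neval s i) (neval s e)) (rmem s))
  | exec_rset s x i e :
      exec (RSet x i e) s (ncost i + rcost e).+1
           (State (nmem s) (upd (rmem s) x (neval s i) (reval s e)))
  | exec_seq c1 c2 s1 s2 s3 t1 t2 :
      exec c1 s1 t1 s2 -> exec c2 s2 t2 s3 ->
      exec (Seq c1 c2) s1 (t1 + t2) s3
  | exec_if_true e c1 c2 s s' t :
      beval s e -> exec c1 s t s' ->
      exec (If e c1 c2) s (bcost e + t).+1 s'
  | exec_if_false e c1 c2 s s' t :
      ~~ beval s e -> exec c2 s t s' ->
      exec (If e c1 c2) s (bcost e + t).+1 s'
  | exec_while_end e c s :
      ~~ beval s e -> exec (While e c) s (bcost e).+1 s
  | exec_while_step e c s1 s2 s3 t1 t2 :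
      beval s1 e -> exec c s1 t1 s2 -> exec (While e c) s2 t2 s3 ->
      exec (While e c) s1 (bcost e + t1 + t2).+1 s3.

Lemma exec_det c s t1 s1 t2 s2 :
  exec c s t1 s1 -> exec c s t2 s2 -> t1 = t2 /\ s1 = s2.
Proof.
move=> H; elim: H t2 s2 => {c s t1 s1}
  [s|s x i e|s x i e|c1 c2 s1 s2 s3 t1 t2 _ IH1 _ IH2|e c1 c2 s s' t be _ IH
  |e c1 c2 s s' t be _ IH|e c s be|e c s1 s2 s3 t1 t2 be _ IH1 _ IH2] t' u H;
  inversion H; subst=> //;
  repeat match goal with
  | IH : forall t s, exec ?c ?s0 t s -> _, E : exec ?c ?s0 _ _ |- _ =>
      case: (IH _ _ E) => ? ?; subst; clear E
  | P : is_true (beval ?s ?e), Q : is_true (~~ beval ?s ?e) |- _ =>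
      by rewrite P in Q
  end; by [].
Qed.

(* Input: n in cell 0 of integer array 0; the a_i and the b_i in cells
   0, ..., n-1 of real arrays 0 and 1; eps in cell 0 of real array 2.  All other
   cells contain zero. *)
Definition input (n : nat) (a b : 'I_n -> R) (eps : R) : state :=
  State
    (fun x i => if (x == 0%N) && (i == 0%N) then n else 0%N)
    (fun x i =>
       match x with
       | 0 => oapp a 0 (insub i)
       | 1 => oapp b 0 (insub i)
       | 2 => if i == 0%N then eps else 0
       | _ => 0
       end).

(* Output: the characteristic functions of S_1 and S_2 in cells 0, ..., n-1 of
   integer arrays 1 and 2. *)
Definition output (n : nat) (k : nat) s : {set 'I_n} :=
  [set i : 'I_n | nmem s k i != 0%N].

End Semantics.

(* Main.v *)
Require Import Defs.
From HB Require Import structures.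
From mathcomp Require Import all_boot all_order all_algebra.
From mathcomp Require Import reals.
From mathcomp Require Import zify ring lra.

Set Implicit Arguments.
Unset Strict Implicit.
Unset Printing Implicit Defensive.

Import Order.TTheory GRing.Theory Num.Theory.
Local Open Scope ring_scope.

(**
   Fix an optimal pair [T1, T2]; by symmetry its sums satisfy [y <= x], with [x]
   on the large side.  Guess an index [p] of the largest element, of value [m],
   on the large side, so that [m <= x <= n m].  With [M >= 8 n^2 / eps] and
   [delta = n m / M], rounding every element down to a multiple of [delta] makes
   all the scaled sums of the pair at most [M], hence [2 M + 1] scaled
   differences suffice.  For every prefix of the indices and every scaled
   difference, dynamic programming keeps the pair of disjoint sets whose exact
   sum on the small side is largest.

   The pair [x', y'] found at the scaled difference of the optimal pair
   satisfies [y <= y'] exactly, while [x' - y'] and [x - y] differ by at most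
   [2 n delta], which is at most [eps m / 4].  As the ratio is
   [1 + (x' - y') / y'] and [m <= x], this loses at most a factor [1 + eps],
   even if [y] is tiny compared with [m].  There are [2 n] guesses, and each fills a table of [n] rows of
   [2 M + 1] cells; tracing a cell back takes [n] steps, hence [n^4 / eps] time.
*)

(** * A program logic with time bounds *)

Fixpoint nmods (c : com) : seq nat :=
  match c with
  | NSet x _ _ => [:: x]
  | Seq c1 c2 | If _ c1 c2 => nmods c1 ++ nmods c2
  | While _ c1 => nmods c1
  | _ => [::]
  end.

Fixpoint rmods (c : com) : seq nat :=
  match c with
  | RSet x _ _ => [:: x]
  | Seq c1 c2 | If _ c1 c2 => rmods c1 ++ rmods c2
  | While _ c1 => rmods c1
  | _ => [::]
  end.

Fixpoint loop_free (c : com) : bool :=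
  match c with
  | Seq c1 c2 | If _ c1 c2 => loop_free c1 && loop_free c2
  | While _ _ => false
  | _ => true
  end.

Fixpoint max_cost (c : com) : nat :=
  match c with
  | Skip => 1
  | NSet _ i e => (ncost i + ncost e).+1
  | RSet _ i e => (ncost i + rcost e).+1
  | Seq c1 c2 => max_cost c1 + max_cost c2
  | If e c1 c2 => (bcost e + maxn (max_cost c1) (max_cost c2)).+1
  | While _ _ => 0
  end.

Definition NVar (x : nat) : nexp := NGet x (NLit 0).
Definition RVar (x : nat) : rexp := RGet x (NLit 0).

Definition For (v x : nat) (c : com) : com :=
  Seq (NSet v (NLit 0) (NLit 0))
      (While (BNle (NAdd (NVar v) (NLit 1)) (NVar x))
             (Seq c (NSet v (NLit 0) (NAdd (NVar v) (NLit 1))))).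

Section Logic.
Variable R : realType.
Implicit Types (s : state R) (c : com) (Q : state R -> Prop).

(** Recording whole arrays rather than cells suffices, since every scalar variable occupies an array
    of its own. *)
Definition frame c s s' : Prop :=
  (forall x i, x \notin nmods c -> nmem s' x i = nmem s x i) /\
  (forall x i, x \notin rmods c -> rmem s' x i = rmem s x i).

(** Total correctness: halting is part of the claim. The postcondition may itself be a [runs], which
    is how time bounds compose in [runs_seq] without naming intermediate assertions. *)
Definition runs c s (T : nat) Q : Prop :=
  exists t s', [/\ exec c s t s', (t <= T)%N & Q s'].

(** Symbolic execution of loop-free code; the value at [While] is a dummy, excluded by [loop_free]
    in [runs_step]. *)
Fixpoint step c s : state R :=
  match c with
  | Skip | While _ _ => s
  | NSet x i e => State (upd (nmem s) x (neval s i) (neval s e)) (rmem s)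
  | RSet x i e => State (nmem s) (upd (rmem s) x (neval s i) (reval s e))
  | Seq c1 c2 => step c2 (step c1 s)
  | If e c1 c2 => if beval s e then step c1 s else step c2 s
  end.

Lemma frame_trans c s1 s2 s3 : frame c s1 s2 -> frame c s2 s3 -> frame c s1 s3.
Proof.
by move=> [n1 r1] [n2 r2]; split=> x i h; rewrite ?n2 ?n1 ?r2 ?r1.
Qed.

Lemma frame_sub c c' s s' :
  {subset nmods c <= nmods c'} -> {subset rmods c <= rmods c'} ->
  frame c s s' -> frame c' s s'.
Proof.
move=> hn hr [fn fr]; split=> x i h; [apply: fn|apply: fr]; apply: contra h.
  exact: hn.
exact: hr.
Qed.

Lemma exec_frame c s t s' : exec c s t s' -> frame c s s'.
Proof.
have hl (u v : seq nat) : {subset u <= u ++ v}.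
  by move=> x; rewrite mem_cat => ->.
have hr (u v : seq nat) : {subset v <= u ++ v}.
  by move=> x; rewrite mem_cat => ->; rewrite orbT.
elim=> {c s t s'} //=.
- move=> s x i e; split=> y j //=.
  by rewrite inE /upd => /negPf ->.
- move=> s x i e; split=> y j //=.
  by rewrite inE /upd => /negPf ->.
- move=> c1 c2 s1 s2 s3 t1 t2 _ f1 _ f2; apply: (@frame_trans _ _ s2).
    by apply: (frame_sub _ _ f1); apply: hl.
  by apply: (frame_sub _ _ f2); apply: hr.
- by move=> e c1 c2 s s' t _ _; apply: frame_sub; apply: hl.
- by move=> e c1 c2 s s' t _ _; apply: frame_sub; apply: hr.
- move=> e c s1 s2 s3 t1 t2 _ _ f1 _ f2; exact: frame_trans f1 f2.
Qed.

Lemma runs_frame c s T Q :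
  runs c s T Q -> runs c s T (fun s' => Q s' /\ frame c s s').
Proof.
move=> [t [s' [h1 h2 h3]]]; exists t, s'; split=> //; split=> //.
exact: exec_frame h1.
Qed.

Lemma runs_weaken c s T T' Q Q' :
  runs c s T Q -> (T <= T')%N -> (forall s', Q s' -> Q' s') -> runs c s T' Q'.
Proof.
move=> [t [s' [h1 h2 h3]]] hT hQ; exists t, s'; split=> //.
  exact: leq_trans hT.
exact: hQ.
Qed.

Lemma runs_seq c1 c2 s T1 T2 Q :
  runs c1 s T1 (fun s' => runs c2 s' T2 Q) -> runs (Seq c1 c2) s (T1 + T2) Q.
Proof.
move=> [t1 [s1 [e1 h1 [t2 [s2 [e2 h2 q]]]]]].
exists (t1 + t2)%N, s2; split=> //; first exact: exec_seq e1 e2.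
exact: leq_add.
Qed.

Lemma runs_step c s (Q : state R -> Prop) :
  loop_free c -> Q (step c s) -> runs c s (max_cost c) Q.
Proof.
suff H : forall s, loop_free c ->
    exists2 t, exec c s t (step c s) & (t <= max_cost c)%N.
  by move=> /(H s) [t h1 h2] q; exists t, (step c s).
elim: c => {s} /=.
- by move=> s _; exists 1%N => //; constructor.
- by move=> x i e s _; eexists; [constructor|].
- by move=> x i e s _; eexists; [constructor|].
- move=> c1 IH1 c2 IH2 s /andP[].
  move=> /(IH1 s) [t1 e1 h1] /(IH2 (step c1 s)) [t2 e2 h2].
  by exists (t1 + t2)%N; [exact: exec_seq e1 e2|exact: leq_add].
- move=> e c1 IH1 c2 IH2 s /andP[/(IH1 s) [t1 e1 h1] /(IH2 s) [t2 e2 h2]].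
  case: ifPn => he; eexists.
  + by apply: exec_if_true he e1.
  + by rewrite ltnS leq_add2l leq_max h1.
  + by apply: exec_if_false he e2.
  + by rewrite ltnS leq_add2l leq_max h2 orbT.
- by [].
Qed.

Lemma runs_if e c1 c2 s T Q :
  (beval s e -> runs c1 s T Q) -> (~~ beval s e -> runs c2 s T Q) ->
  runs (If e c1 c2) s (bcost e + T).+1 Q.
Proof.
move=> h1 h2; case: (boolP (beval s e)) => he.
  have [t [s' [ex ht q]]] := h1 he.
  exists (bcost e + t).+1, s'; split=> //; first exact: exec_if_true.
  by rewrite ltnS leq_add2l.
have [t [s' [ex ht q]]] := h2 he.
exists (bcost e + t).+1, s'; split=> //; first exact: exec_if_false.
by rewrite ltnS leq_add2l.
Qed.

(* The first argument of the invariant bounds the number of iterations left. *)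
Lemma runs_while e c (I : nat -> state R -> Prop) N T s :
  I N s ->
  (forall k s1, I k s1 -> beval s1 e -> (0 < k)%N /\ runs c s1 T (I k.-1)) ->
  runs (While e c) s (N * (bcost e + T).+1 + (bcost e).+1)
    (fun s' => ~~ beval s' e /\ exists k, I k s').
Proof.
move=> I0 IS; elim: N s I0 => [|N IH] s I0.
  case: (boolP (beval s e)) => he; first by have [] := IS _ _ I0 he.
  exists (bcost e).+1, s; split; [exact: exec_while_end|by []|].
  by split=> //; exists 0%N.
case: (boolP (beval s e)) => he; last first.
  exists (bcost e).+1, s; split; [exact: exec_while_end|exact: leq_addl|].
  by split=> //; exists N.+1.
have [_ [t1 [s1 [e1 h1 /IH [t2 [s2 [e2 h2 q]]]]]]] := IS _ _ I0 he.
exists (bcost e + t1 + t2).+1, s2; split=> //.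
  exact: exec_while_step he e1 e2.
by move: h1 h2; rewrite mulSn; lia.
Qed.

(** The body ends before the counter is incremented, so its postcondition speaks of the state after
    that update. The frame of the whole loop is handed to the body, so that [I] need only describe
    what the loop changes. *)
Lemma runs_for v x c s N T (I : nat -> state R -> Prop) :
  v \notin nmods c -> x \notin nmods c -> x != v -> nmem s x 0 = N ->
  I 0%N (State (upd (nmem s) v 0 0%N) (rmem s)) ->
  (forall j s1, (j < N)%N -> frame (For v x c) s s1 -> nmem s1 v 0 = j ->
     I j s1 ->
     runs c s1 T (fun s2 =>
       I j.+1 (State (upd (nmem s2) v 0 j.+1) (rmem s2)))) ->
  runs (For v x c) s (N.+1 * (T + 20)) (I N).
Proof.
move=> hv hx hxv hN I0 IS.
(* [runs_while] counts the iterations left and [I] the iterations done; [J] links them by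
   [j + k = N]. *)
set J := fun k s1 => exists j, [/\ (j + k)%N = N, nmem s1 v 0 = j,
  frame (For v x c) s s1 & I j s1].
have hx' s1 : frame (For v x c) s s1 -> nmem s1 x 0 = N.
  by move=> [h _]; rewrite h //= inE mem_cat inE negb_or hxv negb_or hx hxv.
(* Initialization costs 3, the guard 7 and the increment 6; the slack 20 absorbs them. *)
apply: (@runs_weaken _ _ (3 + (N * (7 + (T + 6)).+1 + 8)) _
  (fun s' => ~~ beval s' (BNle (NAdd (NVar v) (NLit 1)) (NVar x)) /\
     exists k, J k s')); last first.
- move=> s' [/= he [k [j [hj hvj fr Ij]]]].
  rewrite (hx' _ fr) hvj in he.
  by have -> : N = j by lia.
- lia.
apply: (@runs_seq _ _ _ 3).
apply: (@runs_step (NSet v (NLit 0) (NLit 0))) => //=.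
apply: (@runs_while _ _ J).
  exists 0%N; split=> //=; first by rewrite /upd !eqxx.
  split=> //= y i; rewrite inE mem_cat /upd.
  by case: eqP.
move=> k s1 [j [hj hvj fr Ij]] /=; rewrite (hx' _ fr) hvj => he.
split; first lia.
apply: (@runs_seq _ _ _ T 6).
have hjN : (j < N)%N by lia.
have := runs_frame (IS j s1 hjN fr hvj Ij).
move/runs_weaken; apply=> // s2 [I2 f2].
apply: (@runs_step (NSet v (NLit 0) (NAdd (NVar v) (NLit 1)))) => //=.
exists j.+1; have e2 : nmem s2 v 0 = j by case: f2 => -> //.
rewrite e2 addn1; split=> //=; first by lia.
  by rewrite /upd !eqxx.
apply: (frame_trans fr); case: f2 => fn frr; split=> y i /= h.
  have [hy1 hy2] : y != v /\ y \notin nmods c.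
    by move: h; rewrite inE mem_cat !negb_or => /and3P[].
  by rewrite /upd (negPf hy1) /= fn.
by apply: frr; move: h; rewrite cats0.
Qed.

End Logic.

(** * The dynamic program *)

(** A labeling [t] encodes a pair of sets by the labels 1 (large side) and 2 (small side); being one
    function, it makes the sets disjoint by construction. The general codomain covers both the exact
    and the scaled weights. *)
Definition selsum (V : nmodType) (t : nat -> nat) (c : nat) (F : nat -> V)
    (k : nat) : V :=
  \sum_(i < k) (if t i == c then F i else 0).

Lemma selsumS (V : nmodType) t c (F : nat -> V) k :
  selsum t c F k.+1 = selsum t c F k + (if t k == c then F k else 0).
Proof. by rewrite /selsum big_ord_recr. Qed.

Lemma eq_selsum (V : nmodType) t t' c (F : nat -> V) k :
  (forall i, (i < k)%N -> t i = t' i) -> selsum t c F k = selsum t' c F k.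
Proof. by move=> h; apply: eq_bigr => i _; rewrite h. Qed.

Lemma selsum_ge0 (R : realType) t c (F : nat -> R) k :
  (forall i, (i < k)%N -> 0 <= F i) -> 0 <= selsum t c F k.
Proof. by move=> h; apply: sumr_ge0 => i _; case: ifP => // _; apply: h. Qed.

Section Table.
Variables (R : realType) (M : nat) (al be : nat -> nat) (f g : nat -> R).

Definition try_large (r : nat -> R * R * nat) k d : R * R * nat :=
  if (al k <= d)%N && ((r d).1.1 <= (r (d - al k)%N).1.1)
  then ((r (d - al k)%N).1.1, (r (d - al k)%N).1.2 + f k, 1%N)
  else ((r d).1.1, (r d).1.2, 0%N).

(** The sign test is essential on this side: adding [g k] could lift the marker -1 to a plausible
    sum, whereas [try_large] copies the small sum and so preserves the marker. *)
Definition try_small (r : nat -> R * R * nat) k d (c : R * R * nat) :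
    R * R * nat :=
  if [&& (d + be k < M.*2.+1)%N, 0 <= (r (d + be k)%N).1.1 &
         c.1.1 <= (r (d + be k)%N).1.1 + g k]
  then ((r (d + be k)%N).1.1 + g k, (r (d + be k)%N).1.2, 2%N)
  else c.

(* [dp_row k d] is the pair of disjoint subsets of the first [k] indices found
   for the scaled difference [d - M], as its sum on the small side (-1 if there
   is no such pair), its sum on the large side, and the set (0 for none, 1 for
   the large and 2 for the small side) to which the last index belongs. *)
Fixpoint dp_row (k d : nat) : R * R * nat :=
  if k is k'.+1 then try_small (dp_row k') k' d (try_large (dp_row k') k' d)
  else (if d == M then 0 else -1, 0, 0%N).

Definition smallsum k d := (dp_row k d).1.1.
Definition largesum k d := (dp_row k d).1.2.
Definition last_choice k d := (dp_row k d).2.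

Definition source k d : nat :=
  match last_choice k.+1 d with
  | 1 => (d - al k)%N
  | 2 => (d + be k)%N
  | _ => d
  end.

(** The labeling met on the path back from cell [d] of row [k]; this is what [decode] writes out. *)
Fixpoint choice k d i : nat :=
  if k is k'.+1 then
    if i == k' then last_choice k d else choice k' (source k' d) i
  else 0%N.

Variant rowS_spec k d : R -> R -> nat -> Prop :=
  | RowSkip : rowS_spec k d (smallsum k d) (largesum k d) 0
  | RowLarge of (al k <= d)%N : rowS_spec k d
      (smallsum k (d - al k)) (largesum k (d - al k) + f k) 1
  | RowSmall of (d + be k < M.*2.+1)%N & 0 <= smallsum k (d + be k) :
      rowS_spec k d (smallsum k (d + be k) + g k) (largesum k (d + be k)) 2.

(** Deliberately forgets the comparisons: soundness and traceback only need to know which transition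
    filled the cell. *)
Lemma rowSP k d :
  rowS_spec k d (smallsum k.+1 d) (largesum k.+1 d) (last_choice k.+1 d).
Proof.
rewrite /smallsum /largesum /last_choice /= /try_small.
case: ifP => [/and3P[h1 h2 _]|_]; first by constructor.
by rewrite /try_large; case: ifP => [/andP[h _]|_]; constructor.
Qed.

Lemma try_small_ge r k d c : c.1.1 <= (try_small r k d c).1.1.
Proof. by rewrite /try_small; case: ifP => // /and3P[]. Qed.

Lemma smallsum_skip k d : smallsum k d <= smallsum k.+1 d.
Proof.
apply: le_trans (try_small_ge _ _ _ _).
by rewrite /try_large; case: ifP => // /andP[].
Qed.

Lemma smallsum_large k d :
  (al k <= d)%N -> smallsum k (d - al k) <= smallsum k.+1 d.
Proof.
move=> hd; apply: le_trans (try_small_ge _ _ _ _); rewrite /try_large hd /=.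
by case: ifP => // /negbT; rewrite -ltNge => /ltW.
Qed.

Lemma smallsum_small k d :
  (d + be k < M.*2.+1)%N -> 0 <= smallsum k (d + be k) ->
  smallsum k (d + be k) + g k <= smallsum k.+1 d.
Proof.
move=> hd h0; rewrite {2}/smallsum /= /try_small hd -/(smallsum k _) h0 /=.
by case: ifP => // /negbT; rewrite -ltNge => /ltW.
Qed.

Lemma choice_lt k d i : (i < k)%N -> choice k.+1 d i = choice k (source k d) i.
Proof. by move=> h /=; rewrite ltn_eqF. Qed.

Lemma choice_last k d : choice k.+1 d k = last_choice k.+1 d.
Proof. by rewrite /= eqxx. Qed.

(** Induction along the traceback. The last two conclusions matter because the program caps its
    scaled weights: only those up to [2 M] are known to be accurate roundings. *)
Lemma dp_row_sound k d : (d < M.*2.+1)%N -> 0 <= smallsum k d ->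
  [/\ largesum k d = selsum (choice k d) 1 f k,
      smallsum k d = selsum (choice k d) 2 g k,
      (M + selsum (choice k d) 1 al k = d + selsum (choice k d) 2 be k)%N,
      forall i, (i < k)%N -> choice k d i = 1%N -> (al i <= M.*2)%N
    & forall i, (i < k)%N -> choice k d i = 2%N -> (be i <= M.*2)%N].
Proof.
elim: k d => [|k IH] d hd.
  rewrite /selsum !big_ord0 /smallsum /largesum /=.
  by case: eqP => [-> //|_]; rewrite ler0N1.
have E (V : nmodType) c (F : nat -> V) : selsum (choice k.+1 d) c F k =
    selsum (choice k (source k d)) c F k.
  by apply: eq_selsum => i; apply: choice_lt.
rewrite !selsumS !choice_last.
rewrite !E.
have E1 i : (i < k.+1)%N -> i = k \/ (i < k)%N /\ choice k.+1 d i =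
    choice k (source k d) i.
  rewrite ltnS leq_eqVlt => /orP[/eqP ->|h]; [by left|right].
  by rewrite choice_lt.
rewrite /source in E1 *; move: (choice_last k d) E1.
case: rowSP => [|h1|h1 h2] /= cl E1 h.
- have [i1 i2 i3 i4 i5] := IH _ hd h; rewrite !addr0; split=> // i /E1.
    by case=> [->|[hi ->]]; [rewrite cl|apply: i4].
  by case=> [->|[hi ->]]; [rewrite cl|apply: i5].
- have hd' : (d - al k < M.*2.+1)%N by lia.
  have [i1 i2 i3 i4 i5] := IH _ hd' h; rewrite !addr0; split=> //.
  + by rewrite i1.
  + by move: i3; lia.
  + by move=> i /E1 [->|[hi ->]]; [lia|apply: i4].
  + by move=> i /E1 [->|[hi ->]]; [rewrite cl|apply: i5].
- have [i1 i2 i3 i4 i5] := IH _ h1 h2; rewrite !addr0; split=> //.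
  + by rewrite i2.
  + by move: i3; lia.
  + by move=> i /E1 [->|[hi ->]]; [rewrite cl|apply: i4].
  + by move=> i /E1 [->|[hi ->]]; [lia|apply: i5].
Qed.

(** Exchange argument: a cell may hold another pair than [t], but giving the next index the same
    label shifts both scaled differences equally, so the stored pair keeps dominating. As both
    scaled sums are at most [M], the path of [t] never leaves the table. *)
Lemma dp_row_complete k t : (forall i, (i < k)%N -> 0 <= g i) ->
  (selsum t 1 al k <= M)%N -> (selsum t 2 be k <= M)%N ->
  selsum t 2 g k <= smallsum k (M + selsum t 1 al k - selsum t 2 be k)%N.
Proof.
elim: k => [|k IH] hg.
  by rewrite /selsum !big_ord0 /smallsum /= addn0 subn0 eqxx.
rewrite !selsumS => hal hbe.
have hg' i : (i < k)%N -> 0 <= g i by move=> h; apply: hg; rewrite ltnW.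
have {IH} := IH hg'.
move: hal hbe; set A := selsum t 1 al k; set B := selsum t 2 be k.
set G := selsum t 2 g k; rewrite -[A + _]/(A + _)%N -[B + _]/(B + _)%N.
move=> hal hbe.
have -> : (A <= M)%N by lia.
have -> : (B <= M)%N by lia.
have G0 : 0 <= G by apply: selsum_ge0.
move=> /(_ isT isT) IH.
case: (eqVneq (t k) 1%N) hal hbe => [-> /=|h1] hal hbe.
  rewrite addr0 addn0; apply: (le_trans IH).
  have -> : (M + A - B = M + (A + al k) - B - al k)%N by lia.
  apply: smallsum_large; lia.
rewrite addn0.
case: (eqVneq (t k) 2%N) hbe => [h2|h2] hbe; last first.
  by rewrite addr0 addn0; apply: le_trans IH (smallsum_skip _ _).
have E : (M + A - B = M + A - (B + be k) + be k)%N by lia.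
rewrite E in IH.
apply: (@le_trans _ _ (smallsum k (M + A - (B + be k) + be k) + g k)).
  by rewrite lerD2r.
apply: smallsum_small; last exact: le_trans IH.
lia.
Qed.

End Table.

(** * Effect of the rounding on the ratio *)

Definition ratio2 (R : realType) (x y : R) : R := Num.max x y / Num.min x y.

Lemma ratio2C (R : realType) (x y : R) : ratio2 x y = ratio2 y x.
Proof. by rewrite /ratio2 maxC minC. Qed.

Lemma ratio2E (R : realType) (x y : R) :
  ratio2 x y = if x <= y then y / x else x / y.
Proof.
by rewrite /ratio2; case: leP.
Qed.

Section Approximation.
Variables (R : realType) (delta : R).
Hypothesis delta_gt0 : 0 < delta.
Implicit Types (t w : nat -> nat) (F : nat -> R) (k : nat).

Lemma selsum_scaled_le t c w F k :
  (forall i, (i < k)%N -> (w i)%:R * delta <= F i) ->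
  (selsum t c w k)%:R * delta <= selsum t c F k.
Proof.
elim: k => [|k IH] h; first by rewrite /selsum !big_ord0 mul0r.
rewrite !selsumS natrD mulrDl lerD ?IH //.
  by move=> i hi; apply: h; rewrite ltnW.
by case: ifP => _; [apply: h|rewrite mul0r].
Qed.

(** Every selected element loses at most one [delta]. The rounding bound is assumed for selected
    indices only, since it may fail for capped weights. *)
Lemma selsum_scaled_ge t c w F k :
  (forall i, (i < k)%N -> t i = c -> F i <= (w i).+1%:R * delta) ->
  selsum t c F k <= (selsum t c w k + k)%:R * delta.
Proof.
elim: k => [|k IH] h; first by rewrite /selsum !big_ord0 mul0r.
have {}IH := IH (fun i hi => h i (ltnW hi)).
rewrite !selsumS; case: eqP => [/(h k (ltnSn k)) hk|_].
  apply: (le_trans (lerD IH hk)); rewrite -mulrDl -natrD.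
  by rewrite ler_pM2r // ler_nat -[(_ + w k)]/(_ + w k)%N; lia.
rewrite addr0; apply: (le_trans IH); rewrite ler_pM2r // ler_nat.
by rewrite -[(_ + 0)]/(_ + 0)%N; lia.
Qed.

(* The two error bounds say that the difference of the sums is found up to [e];
   the cell optimizes the small side, hence [y <= y']. *)
Lemma ratio2_approx (m x y x' y' e eps : R) :
  0 < m -> 0 < eps -> eps < 1 -> 4 * e <= eps * m ->
  0 < y -> y <= x -> m <= x -> y <= y' ->
  x' - y' <= x - y + e -> x - y <= x' - y' + e ->
  0 < x' /\ ratio2 x' y' <= (1 + eps) * (x / y).
Proof.
move=> m0 e0 e1 he y0 hyx hmx hy h1 h2.
have em : eps * m < m by rewrite -[ltRHS]mul1r ltr_pM2r.
have y'0 : 0 < y' by lra.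
have x0 : 0 < x by lra.
(* If the sides have swapped, [y' - x' <= e] because [y <= x], while [x' >= x - e] exceeds [m / 2];
   hence the excess [e] is at most [eps * x']. *)
rewrite ratio2E; case: (leP x' y') => hxy.
  have x'0 : 0 < x' by lra.
  split=> //; apply: (@le_trans _ _ (1 + eps)); last first.
    rewrite -[leLHS]mulr1 ler_pM2l; last lra.
    by rewrite ler_pdivlMr // mul1r.
  rewrite ler_pdivrMr // mulrDl mul1r.
  have : eps * (m / 2) <= eps * x' by rewrite ler_pM2l //; lra.
  lra.
split; first lra.
rewrite ler_pdivrMr //.
have hx : 4 * e <= eps * x.
  by apply: (le_trans he); rewrite ler_pM2l.
have -> : (1 + eps) * (x / y) * y' = (1 + eps) * x * (y' / y) by ring.
(* With [q = y' / y >= 1], one has [x' <= y' + (x - y + e) <= y * q + (x - y + e) * q = (x + e) *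
   q], and [e <= eps * x]. *)
have hq : 1 <= y' / y by rewrite ler_pdivlMr // mul1r.
have hd : 0 <= (x - y + e) by lra.
have : (x - y + e) * 1 <= (x - y + e) * (y' / y) by rewrite ler_wpM2l.
have hyy : y * (y' / y) = y' by rewrite mulrC divfK // gt_eqF.
have : e * (y' / y) <= eps * x * (y' / y) by rewrite ler_pM2r; lra.
by move: hyy; set q := y' / y => *; lra.
Qed.

Lemma table_approx (n M : nat) (al be : nat -> nat) (f g : nat -> R) (m eps : R)
    (t : nat -> nat) :
  (forall i, (i < n)%N -> 0 <= g i) ->
  (forall i, (i < n)%N -> (al i)%:R * delta <= f i) ->
  (forall i, (i < n)%N -> (be i)%:R * delta <= g i) ->
  (forall i, (i < n)%N -> (al i <= M.*2)%N -> f i <= (al i).+1%:R * delta) ->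
  (forall i, (i < n)%N -> (be i <= M.*2)%N -> g i <= (be i).+1%:R * delta) ->
  0 < m -> 0 < eps -> eps < 1 ->
  M%:R * delta = n%:R * m -> 8 * (n%:R * delta) <= eps * m ->
  0 < selsum t 2 g n -> selsum t 2 g n <= selsum t 1 f n ->
  m <= selsum t 1 f n -> selsum t 1 f n <= n%:R * m ->
  exists d, [/\ (d < M.*2.+1)%N, 0 < largesum M al be f g n d,
    0 < smallsum M al be f g n d
    & ratio2 (largesum M al be f g n d) (smallsum M al be f g n d)
        <= (1 + eps) * (selsum t 1 f n / selsum t 2 g n)].
Proof.
move=> g0 alo blo ahi bhi m0 e0 e1 hM hd y0 hyx hmx hxm.
have a1 := selsum_scaled_le t 1 alo.
have b1 := selsum_scaled_le t 2 blo.
(* As [M * delta = n * m] is at least the larger sum, both scaled sums fit in [M]; in particular no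
   weight selected by [t] is capped. *)
have aM : (selsum t 1 al n <= M)%N.
  by rewrite -(ler_nat R) -(ler_pM2r delta_gt0) hM; apply: le_trans hxm.
have bM : (selsum t 2 be n <= M)%N.
  rewrite -(ler_nat R) -(ler_pM2r delta_gt0) hM.
  by apply: le_trans hxm; apply: le_trans hyx.
have hY := dp_row_complete f g0 aM bM.
have a2 : selsum t 1 f n <= (selsum t 1 al n + n)%:R * delta.
  apply: selsum_scaled_ge => i hi ti; apply: ahi => //.
  have : (al i <= selsum t 1 al n)%N.
    by rewrite /selsum (bigD1 (Ordinal hi)) //= ti eqxx leq_addr.
  by clear -aM; lia.
have b2 : selsum t 2 g n <= (selsum t 2 be n + n)%:R * delta.
  apply: selsum_scaled_ge => i hi ti; apply: bhi => //.
  have : (be i <= selsum t 2 be n)%N.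
    by rewrite /selsum (bigD1 (Ordinal hi)) //= ti eqxx leq_addr.
  by clear -bM; lia.
move: hY; set d := (X in smallsum _ _ _ _ _ _ X) => hY.
have hdW : (d < M.*2.+1)%N by clear -aM bM; rewrite /d; lia.
have Y0 : 0 < smallsum M al be f g n d by apply: lt_le_trans hY.
exists d; have [s1 s2 s3 s4 s5] := dp_row_sound hdW (ltW Y0).
have a1' := selsum_scaled_le (choice M al be f g n d) 1 alo.
have b1' := selsum_scaled_le (choice M al be f g n d) 2 blo.
have a2' : selsum (choice M al be f g n d) 1 f n <= _ :=
  selsum_scaled_ge (fun i hi ti => ahi i hi (s4 i hi ti)).
have b2' : selsum (choice M al be f g n d) 2 g n <= _ :=
  selsum_scaled_ge (fun i hi ti => bhi i hi (s5 i hi ti)).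
rewrite -s1 in a1' a2'; rewrite -s2 in b1' b2'.
have hs : (selsum (choice M al be f g n d) 1 al n)%:R * delta +
    (selsum t 2 be n)%:R * delta =
    (selsum (choice M al be f g n d) 2 be n)%:R * delta +
    (selsum t 1 al n)%:R * delta.
  rewrite -!mulrDl -!natrD; congr (_ %:R * _).
  by move: s3; clear -aM bM; rewrite /d; lia.
rewrite natrD mulrDl in a2; rewrite natrD mulrDl in b2.
rewrite natrD mulrDl in a2'; rewrite natrD mulrDl in b2'.
(* Both pairs have the same scaled difference, and for each of them the exact difference is within
   [n * delta] of it in units of [delta]; hence the error [2 * (n * delta)]. *)
have [|||x'0 hr] := @ratio2_approx m _ _ (largesum M al be f g n d)
  (smallsum M al be f g n d) (2 * (n%:R * delta)) eps m0 e0 e1 _ y0 hyx hmx hY.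
- by clear -hd; lra.
- by clear -a2' b1' hs a1 b2; lra.
- by clear -b2' a1' hs a2 b1; lra.
by split.
Qed.

End Approximation.

(** * The program *)

(* Scalars are cells 0 of the arrays [v...] (integers) and [r...] (reals); the
   arrays [a...] hold the scaled weights ([aal], [abe]) and the table ([aY],
   [aX], [aH]), with [dp_row k d] in cell [k * (2 M + 1) + d]. *)
Local Notation vn := 0%N (only parsing).
Local Notation vM := 3%N (only parsing).
Local Notation vW := 4%N (only parsing).
Local Notation vp := 5%N (only parsing).
Local Notation vi := 6%N (only parsing).
Local Notation vk := 7%N (only parsing).
Local Notation vd := 8%N (only parsing).
Local Notation vbase := 9%N (only parsing).
Local Notation vc := 10%N (only parsing).
Local Notation vb := 11%N (only parsing).
Local Notation vj := 12%N (only parsing).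
Local Notation aal := 13%N (only parsing).
Local Notation abe := 14%N (only parsing).
Local Notation aH := 15%N (only parsing).
Local Notation vh := 16%N (only parsing).

Local Notation reps := 2%N (only parsing).
Local Notation rdelta := 3%N (only parsing).
Local Notation aY := 4%N (only parsing).
Local Notation aX := 5%N (only parsing).
Local Notation rbest := 6%N (only parsing).
Local Notation rr := 7%N (only parsing).
Local Notation ry := 8%N (only parsing).
Local Notation rx := 9%N (only parsing).

Definition NPut x e : com := NSet x (NLit 0) e.
Definition RPut x e : com := RSet x (NLit 0) e.
Definition RLit k : rexp := RCast (NLit k).

Section Program.
(* [sw] tells whether the [b_i] form the large side. *)
Variable sw : bool.

Definition inL : nat := if sw then 1 else 0.
Definition inS : nat := if sw then 0 else 1.
Definition outL : nat := if sw then 2 else 1.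
Definition outS : nat := if sw then 1 else 2.

(** Without rounding on the machine, a scaled weight is counted up in unit steps. Stopping at
    [2 M + 1] bounds the time for elements far above the guessed maximum; a weight beyond [2 M] fits
    no transition of the table anyway. *)
Definition weight_guard (A arr : nat) : bexp :=
  BAnd (BNle (NGet arr (NVar vi)) (NAdd (NVar vM) (NVar vM)))
       (BRle (RMul (RCast (NAdd (NGet arr (NVar vi)) (NLit 1))) (RVar rdelta))
             (RGet A (NVar vi))).

Definition weights (A arr : nat) : com :=
  For vi vn
    (Seq (NSet arr (NVar vi) (NLit 0))
         (While (weight_guard A arr)
            (NSet arr (NVar vi) (NAdd (NGet arr (NVar vi)) (NLit 1))))).

Definition init_table : com :=
  Seq (For vd vW
         (Seq (RSet aY (NVar vd) (RSub (RLit 0) (RLit 1)))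
              (RSet aX (NVar vd) (RLit 0))))
      (RSet aY (NVar vM) (RLit 0)).

(** Integers cannot be multiplied, so the offset [k * (2 M + 1)] of the current row is maintained by
    additions. *)
Definition at_base (e : nexp) : nexp := NAdd (NVar vbase) e.

Definition load_skip : com :=
  Seq (RPut ry (RGet aY (at_base (NVar vd))))
  (Seq (RPut rx (RGet aX (at_base (NVar vd))))
       (NPut vh (NLit 0))).

Definition load_large : com :=
  let src := NSub (NVar vd) (NGet aal (NVar vk)) in
  If (BAnd (BNle (NGet aal (NVar vk)) (NVar vd))
           (BRle (RVar ry) (RGet aY (at_base src))))
     (Seq (RPut ry (RGet aY (at_base src)))
     (Seq (RPut rx (RAdd (RGet aX (at_base src)) (RGet inL (NVar vk))))
          (NPut vh (NLit 1))))
     Skip.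

Definition load_small : com :=
  let src := NAdd (NVar vd) (NGet abe (NVar vk)) in
  let y := RGet aY (at_base src) in
  If (BAnd (BNle (NAdd src (NLit 1)) (NVar vW))
     (BAnd (BRle (RLit 0) y)
           (BRle (RVar ry) (RAdd y (RGet inS (NVar vk))))))
     (Seq (RPut ry (RAdd y (RGet inS (NVar vk))))
     (Seq (RPut rx (RGet aX (at_base src)))
          (NPut vh (NLit 2))))
     Skip.

Definition store : com :=
  let dst := at_base (NAdd (NVar vW) (NVar vd)) in
  Seq (RSet aY dst (RVar ry))
  (Seq (RSet aX dst (RVar rx))
       (NSet aH dst (NVar vh))).

Definition relax : com :=
  Seq load_skip (Seq load_large (Seq load_small store)).

Definition fill_row : com :=
  Seq (For vd vW relax) (NPut vbase (at_base (NVar vW))).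

Definition fill : com := Seq (NPut vbase (NLit 0)) (For vk vn fill_row).

(** Both output cells are cleared before one is set, as they may hold labels of an earlier
    solution. *)
Definition decode_step : com :=
  Seq (NPut vj (NSub (NVar vj) (NLit 1)))
  (Seq (NPut vh (NGet aH (NAdd (NVar vb) (NVar vc))))
  (Seq (NSet outL (NVar vj) (NLit 0))
  (Seq (NSet outS (NVar vj) (NLit 0))
  (Seq (NPut vb (NSub (NVar vb) (NVar vW)))
  (If (BNle (NLit 1) (NVar vh))
    (If (BNle (NVar vh) (NLit 1))
       (Seq (NSet outL (NVar vj) (NLit 1))
            (NPut vc (NSub (NVar vc) (NGet aal (NVar vj)))))
       (Seq (NSet outS (NVar vj) (NLit 1))
            (NPut vc (NAdd (NVar vc) (NGet abe (NVar vj))))))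
    Skip))))).

Definition decode : com :=
  Seq (Seq (NPut vc (NVar vd)) (Seq (NPut vb (NVar vbase)) (NPut vj (NVar vn))))
      (While (BNle (NLit 1) (NVar vj)) decode_step).

Definition set_ratio (x y : rexp) (z : nat) : com :=
  If (BRle x y) (RPut z (RDiv y x)) (RPut z (RDiv x y)).

(** Positive sums certify nonempty sets and exclude the marker -1. Decoding at every improvement is
    affordable: [n] steps for each of [2 M + 1] cells is the order of the time that fills the
    table. *)
Definition select_cell : com :=
  let x := RGet aX (at_base (NVar vd)) in
  let y := RGet aY (at_base (NVar vd)) in
  If (BAnd (BNot (BRle x (RLit 0))) (BNot (BRle y (RLit 0))))
     (Seq (set_ratio x y rr)
          (If (BNot (BRle (RVar rbest) (RVar rr)))
              (Seq (RPut rbest (RVar rr)) decode)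
              Skip))
     Skip.

Definition guess : com :=
  Seq (RPut rdelta
         (RDiv (RMul (RCast (NVar vn)) (RGet inL (NVar vp))) (RCast (NVar vM))))
  (Seq (weights inL aal)
  (Seq (weights inS abe)
  (Seq init_table
  (Seq fill
       (For vd vW select_cell))))).

Definition phase : com := For vp vn guess.

End Program.

Definition find_M : com :=
  Seq (NPut vM (NLit 1))
      (While (BNot (BRle (RMul (RLit 8)
                               (RMul (RCast (NVar vn)) (RCast (NVar vn))))
                         (RMul (RVar reps) (RCast (NVar vM)))))
             (NPut vM (NAdd (NVar vM) (NLit 1)))).

(** Starts from the singletons of the indices 0 and 1, feasible since [n >= 2], so that a solution
    is stored from now on; the other output cells are still zero. *)
Definition setup : com :=
  Seq (NPut vW (NAdd (NAdd (NVar vM) (NVar vM)) (NLit 1)))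
  (Seq (NSet 1 (NLit 0) (NLit 1))
  (Seq (NSet 2 (NLit 1) (NLit 1))
       (set_ratio (RGet 0 (NLit 0)) (RGet 1 (NLit 1)) rbest))).

Definition prog : com :=
  Seq find_M (Seq setup (Seq (phase false) (phase true))).

(** * Correctness of the scaled weights and of the initial row *)

Section Correctness.
Variable R : realType.
Implicit Types s : state R.

Lemma weights_spec A arr s n M delta (F : nat -> R) :
  (A < 2)%N -> (arr == aal) || (arr == abe) ->
  nmem s vn 0 = n -> nmem s vM 0 = M -> rmem s rdelta 0 = delta ->
  (forall i, rmem s A i = F i) -> (forall i, (i < n)%N -> 0 <= F i) ->
  runs (weights A arr) s (n.+1 * (100 * M.+1))
    (fun s' => forall i, (i < n)%N -> (nmem s' arr i)%:R * delta <= F i /\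
       ((nmem s' arr i <= M.*2)%N -> F i <= (nmem s' arr i).+1%:R * delta)).
Proof.
move=> hA harr hn hM hdel hF F0.
pose ok (w : nat) i :=
  w%:R * delta <= F i /\ ((w <= M.*2)%N -> F i <= w.+1%:R * delta).
have arrN x : (x < 13)%N -> (x == arr) = false.
  by move=> hx; case/orP: harr => /eqP ->; apply: ltn_eqF; lia.
apply: (@runs_weaken _ _ _ (n.+1 * ((4 + (M.*2.+1 * (23 + 8).+1 + 24)) + 20)) _
   (fun s' => forall i, (i < n)%N -> ok (nmem s' arr i) i)) => //; last by lia.
apply: (@runs_for _ _ _ _ _ _ _
  (fun j s' => forall i, (i < j)%N -> ok (nmem s' arr i) i)) => //=.
- by rewrite !inE !arrN.
- by rewrite !inE !arrN.
move=> j s1 hj [fn fr] hvj IH.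
have hM1 : nmem s1 vM 0 = M by rewrite fn // !inE !arrN.
have hd1 : rmem s1 rdelta 0 = delta by rewrite fr.
have hF1 i : rmem s1 A i = F i by rewrite fr.
apply: (@runs_seq _ _ _ _ 4).
apply: (@runs_step _ (NSet arr (NVar vi) (NLit 0))) => //=; rewrite hvj.
set s2 := State _ _.
(* The cap leaves at most [2 M + 1 - w] further increments. *)
set I := fun k s' => exists2 w, (w + k = M.*2.+1)%N &
  w%:R * delta <= F j /\
  (forall x i, nmem s' x i =
     if (x == arr) && (i == j) then w else nmem s1 x i) /\
  (forall x i, rmem s' x i = rmem s1 x i).
apply: (@runs_weaken _ _ _ (M.*2.+1 * (23 + 8).+1 + 24) _ (fun s' =>
   ~~ beval s' (weight_guard A arr) /\ exists k, I k s')) => //.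
  apply: runs_while.
    by exists 0%N; rewrite ?add0n // mul0r; split=> //; apply: F0.
  move=> k s' [w hw [hlo [hnm hrm]]] /=.
  have hv' : nmem s' vi 0 = j by rewrite hnm arrN.
  rewrite hv' !hnm !hrm !eqxx /= !arrN //= hM1 hd1 hF1 => /andP[h1 h2].
  split; first lia.
  apply: (@runs_step _
    (NSet arr (NVar vi) (NAdd (NGet arr (NVar vi)) (NLit 1)))) => //.
  exists (w + 1)%N; first lia.
  split=> //; split=> // x i /=.
  by rewrite /upd hv' !hnm !eqxx /=; case: (x == arr); case: (i == j).
move=> s' [/= hg [k [w hw [hlo [hnm hrm]]]]] i.
rewrite ltnS leq_eqVlt => /orP[/eqP ->|hi]; last first.
  by rewrite /upd [arr == _]eq_sym arrN //= hnm eqxx (ltn_eqF hi) /=; apply: IH.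
rewrite /upd [arr == _]eq_sym arrN //= hnm !eqxx /=; split=> // hwM.
have hv' : nmem s' vi 0 = j by rewrite hnm arrN.
move: hg; rewrite hv' !hnm !hrm !eqxx /= !arrN //= hM1 hd1 hF1 negb_and.
by rewrite addnn hwM /= -ltNge addn1 => /ltW.
Qed.

Lemma init_table_spec s M (al be : nat -> nat) (f g : nat -> R) :
  nmem s vM 0 = M -> nmem s vW 0 = M.*2.+1 ->
  runs init_table s (100 * M.+1)
    (fun s' => forall d, (d < M.*2.+1)%N ->
       rmem s' aY d = smallsum M al be f g 0 d /\
       rmem s' aX d = largesum M al be f g 0 d).
Proof.
move=> hM hW.
apply: (@runs_weaken _ _ _ (M.*2.+2 * (13 + 20) + 5) _ _ _ _ _
  (fun s' h => h)); last by lia.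
apply: runs_seq; apply: runs_weaken; first apply: runs_frame.
- apply: (@runs_for _ _ _ _ _ M.*2.+1 13 (fun j s' => forall d, (d < j)%N ->
    rmem s' aY d = -1 /\ rmem s' aX d = 0)) => //.
  move=> j s1 hj fr hvj IH; apply: runs_step => //= d; rewrite /upd /= hvj.
  rewrite ltnS leq_eqVlt => /orP[/eqP ->|hd].
    by rewrite eqxx mulr0n sub0r.
  by rewrite (ltn_eqF hd); apply: IH.
- by [].
move=> s1 [h1 [fn fr]]; apply: runs_step => //= d hd.
rewrite /upd /= fn // hM /smallsum /largesum /=; have [h2 h3] := h1 _ hd.
by case: eqP.
Qed.

(** * Computing one cell of the table *)

Definition agree_except (x : nat) s s' : Prop :=
  (forall y i, y != x -> nmem s' y i = nmem s y i) /\
  (forall y i, (y < ry)%N -> rmem s' y i = rmem s y i).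

Definition loaded s s' (c : R * R * nat) : Prop :=
  [/\ rmem s' ry 0 = c.1.1, rmem s' rx 0 = c.1.2, nmem s' vh 0 = c.2 &
      agree_except vh s s'].

Lemma lt_ry y : (y < ry)%N -> (y == ry) = false /\ (y == rx) = false.
Proof. by move=> hy; split; apply: ltn_eqF; lia. Qed.

Section Relax.
Variables (sw : bool) (s : state R) (M : nat) (r : nat -> R * R * nat).
Variables (bs k d : nat).
Hypothesis hW : nmem s vW 0 = M.*2.+1.
Hypothesis hb : nmem s vbase 0 = bs.
Hypothesis hd : nmem s vd 0 = d.
Hypothesis hk : nmem s vk 0 = k.
Hypothesis hdW : (d < M.*2.+1)%N.
Hypothesis hr : forall e, (e < M.*2.+1)%N ->
  rmem s aY (bs + e) = (r e).1.1 /\ rmem s aX (bs + e) = (r e).1.2.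

Let c0 := ((r d).1.1, (r d).1.2, 0%N).
Let c1 := try_large (nmem s aal) (rmem s (inL sw)) r k d.
Let c2 := try_small M (nmem s abe) (rmem s (inS sw)) r k d c1.

Lemma load_skip_spec : loaded s (step load_skip s) c0.
Proof.
have [h1 h2] := hr hdW; rewrite /= hb hd.
split=> //=; split=> y i hy /=; rewrite /upd //.
  by rewrite (negPf hy).
by have [-> ->] := lt_ry hy.
Qed.

Lemma load_large_spec s1 :
  loaded s s1 c0 -> loaded s (step (load_large sw) s1) c1.
Proof.
rewrite /c1 /try_large => -[l1 l2 l3 [l4 l5]].
rewrite /load_large /= !l4 //= l1 !l5 // ?hb ?hd ?hk.
case: (leqP (nmem s aal k) d) => hle /=; last by split.
have hdW' : (d - nmem s aal k < M.*2.+1)%N by lia.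
have [e1 e2] := hr hdW'; rewrite e1.
have hin : (inL sw < ry)%N by case: (sw).
have [n1 n2] := lt_ry hin.
case: ifP => _; last by split.
split=> //=.
- by rewrite /upd n1 /= ?l5 ?e2.
- split=> y i hy /=; first by rewrite /upd (negPf hy) /= l4.
  by rewrite /upd; have [-> ->] := lt_ry hy; apply: l5.
Qed.

Lemma load_small_spec s1 :
  loaded s s1 c1 -> loaded s (step (load_small sw) s1) c2.
Proof.
rewrite /c2 /try_small; move: c1 => c [l1 l2 l3 [l4 l5]].
have hin : rmem s1 (inS sw) k = rmem s (inS sw) k by rewrite l5 //; case: (sw).
rewrite /load_small /= !l4 //= l1 ?hb ?hd ?hk ?hW addn1 hin !l5 // mulr0n.
case: (ltnP (d + nmem s abe k) M.*2.+1) => hle /=; last by split.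
have [e1 e2] := hr hle; rewrite e1.
case: ifP => _; last by split.
split=> //=.
- by rewrite /upd /= l5.
- split=> y i hy /=; first by rewrite /upd (negPf hy) /= l4.
  by rewrite /upd; have [-> ->] := lt_ry hy; apply: l5.
Qed.

Lemma relax_spec (dst := (bs + (M.*2.+1 + d))%N) :
  runs (relax sw) s 200 (fun s' =>
    [/\ forall j, rmem s' aY j = if j == dst then c2.1.1 else rmem s aY j,
        forall j, rmem s' aX j = if j == dst then c2.1.2 else rmem s aX j &
        forall j, nmem s' aH j = if j == dst then c2.2 else nmem s aH j]).
Proof.
apply: (@runs_weaken _ _ _ (max_cost (relax sw)) _ _ _ _ _ (fun s' h => h));
  last by case: (sw).
apply: runs_step; first by case: (sw).
have := load_small_spec (load_large_spec load_skip_spec).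
rewrite -[step (relax sw) s]/(step store (step (load_small sw)
  (step (load_large sw) (step load_skip s)))).
move: (step (load_small sw) _) => s3 [l1 l2 l3 [l4 l5]].
by split=> j; rewrite /store /= /upd /= ?l1 ?l2 ?l3 !l4 // ?l5 // hb hd hW.
Qed.

End Relax.

(** * Filling the table *)

Definition table_rows s M (al be : nat -> nat) (f g : nat -> R) k : Prop :=
  forall i d, (i <= k)%N -> (d < M.*2.+1)%N ->
    [/\ rmem s aY (i * M.*2.+1 + d) = smallsum M al be f g i d,
        rmem s aX (i * M.*2.+1 + d) = largesum M al be f g i d &
        (0 < i)%N -> nmem s aH (i * M.*2.+1 + d) = last_choice M al be f g i d].

Lemma fill_spec sw s M n al be f g :
  (forall i, nmem s aal i = al i) -> (forall i, nmem s abe i = be i) ->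
  (forall i, rmem s (inL sw) i = f i) -> (forall i, rmem s (inS sw) i = g i) ->
  nmem s vn 0 = n -> nmem s vW 0 = M.*2.+1 ->
  (forall d, (d < M.*2.+1)%N ->
       rmem s aY d = smallsum M al be f g 0 d /\
       rmem s aX d = largesum M al be f g 0 d) ->
  runs (fill sw) s (n.+1 * (1000 * M.+1))
    (fun s' => nmem s' vbase 0 = (n * M.*2.+1)%N /\ table_rows s' M al be f g n).
Proof.
move=> hal hbe hf hg hn hW h0; set W := M.*2.+1.
apply: (@runs_weaken _ _ _ (3 + n.+1 * ((W.+1 * (200 + 20) + 7) + 20)) _ _ _ _ _
  (fun s' h => h)); last by rewrite /W; lia.
apply: runs_seq; apply: runs_step => //=; set s0 := State _ _.
apply: (@runs_for _ _ _ _ _ _ _ (fun j s' =>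
  nmem s' vbase 0 = (j * W)%N /\ table_rows s' M al be f g j)) => //;
  try by case: (sw).
- split=> // i d; rewrite leqn0 => /eqP -> hd.
  by rewrite mul0n add0n /=; have [h1 h2] := h0 d hd; split.
move=> k s1 hk [fn fr] hvk [hb IH].
have eal i : nmem s1 aal i = al i by rewrite fn; [apply: hal|case: (sw)].
have ebe i : nmem s1 abe i = be i by rewrite fn; [apply: hbe|case: (sw)].
have ef i : rmem s1 (inL sw) i = f i by rewrite fr; [apply: hf|case: (sw)].
have eg i : rmem s1 (inS sw) i = g i by rewrite fr; [apply: hg|case: (sw)].
have eW : nmem s1 vW 0 = W by rewrite fn //; case: (sw).
apply: runs_seq; apply: runs_weaken; first apply: runs_frame.
- apply: (@runs_for _ _ _ _ _ W 200 (fun j s' => table_rows s' M al be f g k /\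
    forall d, (d < j)%N ->
    [/\ rmem s' aY (k.+1 * W + d) = smallsum M al be f g k.+1 d,
        rmem s' aX (k.+1 * W + d) = largesum M al be f g k.+1 d &
        nmem s' aH (k.+1 * W + d) = last_choice M al be f g k.+1 d])) => //;
  try by case: (sw).
  move=> d s2 hd [fn2 fr2] hvd [T2 IH2].
  have eal2 i : nmem s2 aal i = al i by rewrite fn2 ?eal //; case: (sw).
  have ebe2 i : nmem s2 abe i = be i by rewrite fn2 ?ebe //; case: (sw).
  have ef2 i : rmem s2 (inL sw) i = f i by rewrite fr2 ?ef //; case: (sw).
  have eg2 i : rmem s2 (inS sw) i = g i by rewrite fr2 ?eg //; case: (sw).
  have eb2 : nmem s2 vbase 0 = (k * W)%N by rewrite fn2 //; case: (sw).
  have eW2 : nmem s2 vW 0 = W by rewrite fn2 //; case: (sw).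
  have ek2 : nmem s2 vk 0 = k by rewrite fn2 //; case: (sw).
  have hr : forall e, (e < W)%N ->
     rmem s2 aY (k * W + e) = (dp_row M al be f g k e).1.1 /\
     rmem s2 aX (k * W + e) = (dp_row M al be f g k e).1.2.
    by move=> e he; have [] := T2 k e (leqnn k) he.
  have := relax_spec sw eW2 eb2 hvd ek2 hd hr.
  set c := try_small _ _ _ _ _ _ _.
  have -> : c = dp_row M al be f g k.+1 d.
    by rewrite /c /= /try_small /try_large ebe2 eal2 ef2 eg2.
  rewrite addnA -mulSnr => hrel; apply: (runs_weaken hrel) => // s3 [q1 q2 q3].
  split=> [i e hi he|e] /=.
    (* Rows occupy disjoint blocks of [W] cells, so writing into row [k.+1] preserves the earlier
       rows. *)
    have hne : (i * W + e == k.+1 * W + d)%N = false.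
      by apply: ltn_eqF; have := leq_mul hi (leqnn W); rewrite mulSn; lia.
    by rewrite q1 q2 /upd /= q3 hne; apply: T2.
  rewrite q1 q2 /upd /= q3 eqn_add2l ltnS leq_eqVlt => /orP[/eqP ->|he].
    by rewrite eqxx.
  by rewrite (ltn_eqF he); apply: IH2.
- by [].
move=> s2 [[T2 h2] [fn2 fr2]]; apply: runs_step => //=; split.
  by rewrite /upd /= !fn2 ?hb ?eW ?mulSnr //; case: (sw).
move=> i d; rewrite /upd /= leq_eqVlt => /orP[/eqP ->|hi] hd; last exact: T2.
by have [q1 q2 q3] := h2 d hd; split.
Qed.

(** * Tracing a cell back to its pair of sets *)

Lemma source_lt M al be (f g : nat -> R) k d :
  (d < M.*2.+1)%N -> (source M al be f g k d < M.*2.+1)%N.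
Proof. by rewrite /source; case: rowSP => //; lia. Qed.

Lemma decode_spec sw s M n d al be (f g : nat -> R) :
  nmem s vn 0 = n -> nmem s vW 0 = M.*2.+1 -> nmem s vd 0 = d ->
  nmem s vbase 0 = (n * M.*2.+1)%N -> (d < M.*2.+1)%N ->
  (forall i, nmem s aal i = al i) -> (forall i, nmem s abe i = be i) ->
  table_rows s M al be f g n ->
  runs (decode sw) s (100 * n.+1) (fun s' => forall i, (i < n)%N ->
    nmem s' (outL sw) i = (choice M al be f g n d i == 1%N) /\
    nmem s' (outS sw) i = (choice M al be f g n d i == 2%N)).
Proof.
move=> hn hW hd hb hdW hal hbe hT; set W := M.*2.+1 in hW hb hdW.
pose ok s' i := nmem s' (outL sw) i = (choice M al be f g n d i == 1%N) /\
    nmem s' (outS sw) i = (choice M al be f g n d i == 2%N).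
(* The labels from [k] on are already written; those below [k] are still encoded by cell [c] of row
   [k], at address [vb + vc]. *)
pose I k s' := [/\ nmem s' vj 0 = k, (k <= n)%N, nmem s' vb 0 = (k * W)%N,
  forall x i, x \notin [:: outL sw; outS sw; vc; vb; vj; vh] ->
    nmem s' x i = nmem s x i &
  exists c, [/\ (c < W)%N, nmem s' vc 0 = c,
   forall i, (i < k)%N -> choice M al be f g n d i = choice M al be f g k c i &
   forall i, (k <= i < n)%N -> ok s' i]].
apply: (@runs_weaken _ _ _ (12 + (n * (4 + 70).+1 + 5)) _
  (fun s' => ~~ beval s' (BNle (NLit 1) (NVar vj)) /\ exists k, I k s'));
  last 2 first.
- lia.
- move=> s' [/= hg [k [hj _ _ _ [c [_ _ _ h]]]]] i hi.
  by apply: h; rewrite hi andbT; move: hg; rewrite hj -leqNgt leqn0 => /eqP ->.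
apply: (@runs_seq _ _ _ _ 12); apply: runs_step => //=.
apply: runs_while.
  split=> //=.
  - move=> x i; rewrite /upd !inE !negb_or.
    by case/and5P=> _ _ /negPf-> /negPf-> /andP[/negPf-> _].
  - by exists d; split=> // i; lia.
move=> k s1 [hj hkn hvb hfr [c [hc hvc hch hok]]] /=; rewrite hj => hk.
case: k hk hj hkn hvb hch hok => // k _ hj hkn hvb hch hok; split=> //.
apply: (@runs_weaken _ _ _ (max_cost (decode_step sw)) _ _ _ _ _
  (fun s' h => h)); last by case: (sw).
apply: runs_step; first by case: (sw).
have eW : nmem s1 vW 0 = W by rewrite hfr //; case: (sw).
have eal i : nmem s1 aal i = al i by rewrite hfr //; case: (sw).
have ebe i : nmem s1 abe i = be i by rewrite hfr //; case: (sw).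
have [_ _ /(_ isT) eH] := hT k.+1 c hkn hc.
have {}eH : nmem s1 aH (k.+1 * W + c) = last_choice M al be f g k.+1 c.
  by rewrite hfr //; case: (sw).
have hs := source_lt al be f g k hc.
have eb : (k.+1 * W - W = k * W)%N by rewrite mulSn addKn.
have cl : choice M al be f g n d k = last_choice M al be f g k.+1 c.
  by rewrite hch // choice_last.
have hch' i : (i < k)%N -> choice M al be f g n d i =
    choice M al be f g k (source M al be f g k c) i.
  by move=> hi; rewrite hch ?choice_lt // ltnW.
suff [h1 h2 h3 h4 [h5 h6 h7]] :
    [/\ nmem (step (decode_step sw) s1) vj 0 = k,
     nmem (step (decode_step sw) s1) vb 0 = (k * W)%N,
     nmem (step (decode_step sw) s1) vc 0 = source M al be f g k c,
     (forall x i, x \notin [:: outL sw; outS sw; vc; vb; vj; vh] ->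
        nmem (step (decode_step sw) s1) x i = nmem s1 x i) &
     [/\ ok (step (decode_step sw) s1) k,
       forall i, i != k ->
         nmem (step (decode_step sw) s1) (outL sw) i = nmem s1 (outL sw) i &
       forall i, i != k ->
         nmem (step (decode_step sw) s1) (outS sw) i = nmem s1 (outS sw) i]].
  move: (step (decode_step sw) s1) h1 h2 h3 h4 h5 h6 h7.
  move=> s2 h1 h2 h3 h4 h5 h6 h7; split=> //; first exact: ltnW.
    by move=> x i hx; rewrite h4 // hfr.
  exists (source M al be f g k c); split=> // i /andP[hki hin].
  move: hki; rewrite leq_eqVlt => /orP[/eqP <- //|hki].
  have hik : i != k by rewrite gtn_eqF.
  by rewrite /ok h6 // h7 //; apply: hok; rewrite hki.
rewrite /ok cl /source; clear -hj hvb hvc eW eal ebe eH eb hc.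
(* With three possible choices and two values of [sw], the effect of one step is settled by
   computation. *)
have : (last_choice M al be f g k.+1 c <= 2)%N by case: rowSP.
case: (last_choice M al be f g k.+1 c) eH => [|[|[|h]]] // eH _; case: (sw);
  rewrite /= /upd /= hj hvb hvc subn1 /= eH /=.
all: split; [by []|by rewrite ?eb ?eW ?eb|by rewrite ?eal ?ebe ?hvc| |split].
all: try by rewrite /= ?eqxx.
all: try by move=> i /negPf ->.
all: move=> x i; rewrite !inE !negb_or.
all: case/and5P=> /negPf e1 /negPf e2 /negPf e3 /negPf e4 /andP[].
all: by move=> /negPf e5 /negPf e6; rewrite ?e1 ?e2 ?e3 ?e4 ?e5 ?e6.
Qed.

(** * The stored solution and its improvement *)

Definition memsum (o : nat -> nat) (F : nat -> R) n : R :=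
  \sum_(i < n) (if o i != 0%N then F i else 0).

Lemma memsum_selsum (o t : nat -> nat) (c : nat) F n :
  (forall i, (i < n)%N -> o i = (t i == c)) -> memsum o F n = selsum t c F n.
Proof. by move=> h; apply: eq_bigr => i _; rewrite h //; case: (t i == c). Qed.

(** Positive sums stand for nonempty sets. Tying [best] to the stored pair turns any upper bound on
    [best] into one on the ratio of the output. *)
Definition solution n (f g : nat -> R) (oL oS : nat -> nat) (best : R) : Prop :=
  [/\ forall i, (i < n)%N -> oL i = 0%N \/ oS i = 0%N,
      0 < memsum oL f n, 0 < memsum oS g n &
      best = ratio2 (memsum oL f n) (memsum oS g n)].

Definition holds_solution sw s n f g : Prop :=
  solution n f g (nmem s (outL sw)) (nmem s (outS sw)) (rmem s rbest 0).

Lemma eq_solution n f g oL oS oL' oS' best :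
  (forall i, (i < n)%N -> oL' i = oL i) -> (forall i, (i < n)%N -> oS' i = oS i) ->
  solution n f g oL oS best -> solution n f g oL' oS' best.
Proof.
move=> eL eS; have E o o' F : (forall i, (i < n)%N -> o' i = o i) ->
    memsum o' F n = memsum o F n.
  by move=> h; apply: eq_bigr => i _; rewrite h.
rewrite /solution (E _ _ _ eL) (E _ _ _ eS) => -[h1 h2 h3 h4]; split=> // i hi.
by rewrite eL ?eS //; apply: h1.
Qed.

Lemma select_cell_spec sw s M n d al be (f g : nat -> R) :
  nmem s vn 0 = n -> nmem s vW 0 = M.*2.+1 -> nmem s vd 0 = d ->
  nmem s vbase 0 = (n * M.*2.+1)%N -> (d < M.*2.+1)%N ->
  (forall i, nmem s aal i = al i) -> (forall i, nmem s abe i = be i) ->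
  table_rows s M al be f g n -> holds_solution sw s n f g ->
  let x := largesum M al be f g n d in let y := smallsum M al be f g n d in
  runs (select_cell sw) s (200 * n.+1) (fun s' =>
    [/\ holds_solution sw s' n f g, rmem s' rbest 0 <= rmem s rbest 0 &
        0 < x -> 0 < y -> rmem s' rbest 0 <= ratio2 x y]).
Proof.
move=> hn hW hd hb hdW hal hbe hT hsol x y.
have [ey ex _] := hT n d (leqnn n) hdW; rewrite -/x -/y in ex ey.
apply: (@runs_weaken _ _ _ (21 + (29 + (6 + (4 + 100 * n.+1)).+1)).+1 _ _ _ _ _
  (fun s' h => h)); last by lia.
apply: runs_if => /=; rewrite hb hd ex ey mulr0n -!ltNge; last first.
  move=> hxy; apply: (@runs_weaken _ _ _ 1 _ (fun s' => s' = s)).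
  - exact: runs_step.
  - by lia.
  - by move=> _ ->; split=> // h1 h2; rewrite h1 h2 in hxy.
move=> /andP[x0 y0].
apply: runs_seq; apply: runs_step => //.
set s1 := step _ _.
have [en er eb] : [/\ nmem s1 = nmem s, rmem s1 rr 0 = ratio2 x y &
    forall z i, z != rr -> rmem s1 z i = rmem s z i].
  rewrite ratio2E /s1 /= hb hd ex ey; case: ifP => _; split=> //= z i /negPf hz;
  by rewrite /upd hz.
move: s1 en er eb => s1 en er eb.
apply: runs_if => /=; rewrite eb // er; last first.
  rewrite negbK => hle; apply: (@runs_weaken _ _ _ 1 _ (fun s' => s' = s1)).
  - exact: runs_step.
  - by lia.
  by move=> _ ->; rewrite /holds_solution en eb.
rewrite -ltNge => hlt.
apply: (@runs_seq _ _ _ _ 4); apply: runs_step => //.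
set s2 := step _ _.
have [en2 eb2] : nmem s2 = nmem s /\ rmem s2 rbest 0 = ratio2 x y.
  by rewrite /s2 /= /upd /= en er.
have er2 z i : (z < rbest)%N -> rmem s2 z i = rmem s z i.
  move=> hz; have hz' : z != rr by rewrite neq_ltn (ltn_trans hz).
  by rewrite /s2 /= /upd (ltn_eqF hz) /= eb.
move: s2 en2 eb2 er2 => s2 en2 eb2 er2.
have hT2 : table_rows s2 M al be f g n.
  by move=> i e hi he; rewrite !er2 // en2; apply: hT.
have := @decode_spec sw s2 M n d al be f g; rewrite en2 => /(_ hn hW hd hb hdW).
move=> /(_ hal hbe hT2) /runs_frame hdec.
apply: (runs_weaken hdec) => // s3 [hout [_ fr]].
have -> : rmem s3 rbest 0 = ratio2 x y by rewrite fr //; case: (sw).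
split=> //; last exact: ltW.
have [s_x s_y _ _ _] := dp_row_sound hdW (ltW y0).
rewrite -/x -/y in s_x s_y.
have hL i : (i < n)%N -> _ := fun hi => (hout i hi).1.
have hS i : (i < n)%N -> _ := fun hi => (hout i hi).2.
have mL : memsum (nmem s3 (outL sw)) f n = x.
  by rewrite (@memsum_selsum (nmem s3 (outL sw)) (choice M al be f g n d) 1%N f n).
have mS : memsum (nmem s3 (outS sw)) g n = y.
  by rewrite (@memsum_selsum (nmem s3 (outS sw)) (choice M al be f g n d) 2%N g n).
rewrite /holds_solution /solution mL mS fr ?eb2; last by case: (sw).
split=> //.
- by move=> i hi; rewrite hL // hS //; case: (choice _ _ _ _ _ _ _ _)
    => [|[|h]]; [left|right|left].
Qed.

Lemma select_spec sw s M n al be (f g : nat -> R) :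
  nmem s vn 0 = n -> nmem s vW 0 = M.*2.+1 ->
  nmem s vbase 0 = (n * M.*2.+1)%N ->
  (forall i, nmem s aal i = al i) -> (forall i, nmem s abe i = be i) ->
  table_rows s M al be f g n -> holds_solution sw s n f g ->
  runs (For vd vW (select_cell sw)) s (M.*2.+2 * (200 * n.+1 + 20)) (fun s' =>
    [/\ holds_solution sw s' n f g, rmem s' rbest 0 <= rmem s rbest 0 &
        forall d, (d < M.*2.+1)%N ->
        0 < largesum M al be f g n d -> 0 < smallsum M al be f g n d ->
        rmem s' rbest 0 <=
          ratio2 (largesum M al be f g n d) (smallsum M al be f g n d)]).
Proof.
move=> hn hW hb hal hbe hT hsol.
apply: (@runs_for _ _ _ _ _ M.*2.+1 _ (fun j s' =>
    [/\ holds_solution sw s' n f g, rmem s' rbest 0 <= rmem s rbest 0 &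
        forall d, (d < j)%N ->
        0 < largesum M al be f g n d -> 0 < smallsum M al be f g n d ->
        rmem s' rbest 0 <=
          ratio2 (largesum M al be f g n d) (smallsum M al be f g n d)])) => //;
  try by case: (sw).
  by split=> //; move: hsol; rewrite /holds_solution; case: (sw).
move=> d s1 hd [fn fr] hvd [q1 q2 q3].
have E x : x \in [:: vn; vW; vbase; aal; abe; aH] ->
    forall i, nmem s1 x i = nmem s x i.
  by move=> hx i; apply: fn; move: hx; rewrite !inE;
    do 5 (case/predU1P=> [-> |]; first by case: (sw)); move/eqP->; case: (sw).
have hT1 : table_rows s1 M al be f g n.
  move=> i e hi he; rewrite E // !fr; try by case: (sw).
  exact: hT.
have hal1 i : nmem s1 aal i = al i by rewrite E.
have hbe1 i : nmem s1 abe i = be i by rewrite E.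
have hn1 : nmem s1 vn 0 = n by rewrite E.
have hW1 : nmem s1 vW 0 = M.*2.+1 by rewrite E.
have hb1 : nmem s1 vbase 0 = (n * M.*2.+1)%N by rewrite E.
apply: (runs_weaken (select_cell_spec hn1 hW1 hvd hb1 hd hal1 hbe1 hT1 q1)) => //.
move=> s2 [p1 p2 p3]; split.
- by move: p1; rewrite /holds_solution; case: (sw).
- exact: le_trans q2.
move=> e /=; rewrite ltnS leq_eqVlt => /orP[/eqP -> //|he] h1 h2.
exact: le_trans p2 (q3 _ he h1 h2).
Qed.

(** * Guarantee of one guess and of one phase *)

Definition covers n (f g : nat -> R) p (eps best : R) : Prop :=
  forall t, (forall i, (i < n)%N -> t i = 1%N -> f i <= f p) -> t p = 1%N ->
    0 < selsum t 2 g n -> selsum t 2 g n <= selsum t 1 f n ->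
    best <= (1 + eps) * (selsum t 1 f n / selsum t 2 g n).

Lemma selsum_max_le n (f : nat -> R) p t :
  (forall i, (i < n)%N -> 0 <= f i) -> (p < n)%N ->
  (forall i, (i < n)%N -> t i = 1%N -> f i <= f p) ->
  selsum t 1 f n <= n%:R * f p.
Proof.
move=> f0 hp h; rewrite mulr_natl.
have -> : f p *+ n = \sum_(i < n) f p by rewrite sumr_const card_ord.
apply: ler_sum => i _; case: eqP => [/h|_]; first exact.
exact: f0.
Qed.

Lemma selsum_max_ge n (f : nat -> R) p t :
  (forall i, (i < n)%N -> 0 <= f i) -> (p < n)%N -> t p = 1%N ->
  f p <= selsum t 1 f n.
Proof.
move=> f0 hp h; rewrite /selsum (bigD1 (Ordinal hp)) //= h eqxx lerDl.
by apply: sumr_ge0 => i _; case: ifP => // _; apply: f0.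
Qed.

(** The guess is measured against every labeling whose large side has its maximum at [p], so no
    optimal pair is mentioned. Since [covers] is only an upper bound on [best], it survives all
    later improvements. *)
Lemma guess_spec sw s n M p (f g : nat -> R) eps :
  nmem s vn 0 = n -> nmem s vM 0 = M -> nmem s vW 0 = M.*2.+1 ->
  nmem s vp 0 = p -> (p < n)%N ->
  (forall i, rmem s (inL sw) i = f i) -> (forall i, rmem s (inS sw) i = g i) ->
  (forall i, (i < n)%N -> 0 < f i) -> (forall i, (i < n)%N -> 0 < g i) ->
  0 < eps -> eps < 1 -> (0 < M)%N -> 8 * (n%:R * n%:R) <= eps * M%:R ->
  holds_solution sw s n f g ->
  runs (guess sw) s (2000 * (n.+1 * M.+1)) (fun s' =>
    [/\ holds_solution sw s' n f g, rmem s' rbest 0 <= rmem s rbest 0 &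
        covers n f g p eps (rmem s' rbest 0)]).
Proof.
move=> hn hM hW hvp hp hf hg f0 g0 e0 e1 M0 heps hsol.
have f0' i : (i < n)%N -> 0 <= f i by move=> /f0/ltW.
have g0' i : (i < n)%N -> 0 <= g i by move=> /g0/ltW.
have MR : (0 : R) < M%:R by rewrite ltr0n.
have n0 : (0 < n)%N by apply: leq_trans hp.
have nR : (0 : R) < n%:R by rewrite ltr0n.
pose m := f p; have m0 : 0 < m by apply: f0.
pose delta := n%:R * m / M%:R.
have delta0 : 0 < delta by rewrite divr_gt0 // mulr_gt0.
apply: (@runs_weaken _ _ _ (13 + (n.+1 * (100 * M.+1) + (n.+1 * (100 * M.+1) +
  (100 * M.+1 + (n.+1 * (1000 * M.+1) + M.*2.+2 * (200 * n.+1 + 20))))))%N _ _ _ _ _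
  (fun s' h => h)); last by clear; nia.
apply: (@runs_seq _ _ _ _ 13).
apply: (@runs_step _ (RPut _ _)) => //=; rewrite hn hvp hM hf -/m -/delta.
set s1 := State _ _.
(* A frame depends only on which arrays are assigned, so a dummy expression may replace the value of
   [delta]. *)
have fr1 : frame (RPut rdelta (RLit 0)) s s1.
  by split=> // x i; rewrite /s1 /= inE /upd => /negPf->.
have ed1 : rmem s1 rdelta 0 = delta by [].
move: s1 fr1 ed1 => s1 [fn1 fr1] ed1.
apply: runs_seq.
apply: (runs_weaken (runs_frame (@weights_spec (inL sw) aal s1 n M delta f
  _ _ _ _ _ _ _))) => //; try by [case: (sw)|rewrite fn1].
  by move=> i; rewrite fr1 //; case: (sw).
move=> s2 [hal [fn2 fr2]]; apply: runs_seq.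
apply: (runs_weaken (runs_frame (@weights_spec (inS sw) abe s2 n M delta g
  _ _ _ _ _ _ _))) => //; try by [case: (sw)|rewrite fn2 // fn1|rewrite fr2].
  by move=> i; rewrite fr2 //= fr1 //; case: (sw).
move=> s3 [hbe [fn3 fr3]]; apply: runs_seq.
pose al := nmem s2 aal; pose be := nmem s3 abe.
have eal i : nmem s3 aal i = al i by rewrite fn3.
apply: (runs_weaken (runs_frame (@init_table_spec s3 M al be f g _ _))) => //;
  try by rewrite fn3 // fn2 // fn1.
move=> s4 [hT0 [fn4 fr4]]; apply: runs_seq.
apply: (runs_weaken (runs_frame (@fill_spec sw s4 M n al be f g _ _ _ _ _ _ hT0)))
  => //; try by [move=> i; rewrite fn4|rewrite fn4 // fn3 // fn2 // fn1].
- by move=> i; rewrite fr4 1?fr3 1?fr2 1?fr1 //; case: (sw).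
- by move=> i; rewrite fr4 1?fr3 1?fr2 1?fr1 //; case: (sw).
move=> s5 [[hb5 hT5] [fn5 fr5]].
have hsol5 : holds_solution sw s5 n f g.
  move: hsol; rewrite /holds_solution.
  have -> : rmem s5 rbest 0 = rmem s rbest 0.
    by rewrite fr5 1?fr4 1?fr3 1?fr2 1?fr1 //; case: (sw).
  apply: eq_solution => i hi;
    by rewrite fn5 1?fn4 1?fn3 1?fn2 1?fn1 //; case: (sw).
apply: (runs_weaken (@select_spec sw s5 M n al be f g _ _ hb5 _ _ hT5 hsol5)) => //;
  try by [move=> i; rewrite fn5 // fn4|rewrite fn5 // fn4 // fn3 // fn2 // fn1].
move=> s6 [q1 q2 q3]; split=> //.
  by move: q2; rewrite fr5 1?fr4 1?fr3 1?fr2 1?fr1 //; case: (sw).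
move=> t ht tp y0 hyx.
have hMd : M%:R * delta = n%:R * m by rewrite /delta mulrC divfK // gt_eqF.
(* Here the choice of [M] enters: [8 n delta = 8 n^2 m / M]. The constant 8 is the 4 demanded by
   [ratio2_approx] times the 2 in the error [2 n delta]. *)
have h8 : 8 * (n%:R * delta) <= eps * m.
  rewrite /delta -(ler_pM2r MR).
  have -> : 8 * (n%:R * (n%:R * m / M%:R)) * M%:R = 8 * (n%:R * n%:R) * m.
    by field; rewrite gt_eqF.
  have -> : eps * m * M%:R = eps * M%:R * m by ring.
  by rewrite ler_pM2r.
have [d [hd X0 Y0 hr]] := @table_approx R delta delta0 n M al be f g m eps t
  g0' (fun i hi => (hal i hi).1) (fun i hi => (hbe i hi).1)
  (fun i hi => (hal i hi).2) (fun i hi => (hbe i hi).2)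
  m0 e0 e1 hMd h8 y0 hyx (selsum_max_ge f0' hp tp) (selsum_max_le f0' hp ht).
exact: le_trans (q3 d hd X0 Y0) hr.
Qed.

Lemma phase_spec sw s n M (f g : nat -> R) eps :
  nmem s vn 0 = n -> nmem s vM 0 = M -> nmem s vW 0 = M.*2.+1 ->
  (forall i, rmem s (inL sw) i = f i) -> (forall i, rmem s (inS sw) i = g i) ->
  (forall i, (i < n)%N -> 0 < f i) -> (forall i, (i < n)%N -> 0 < g i) ->
  0 < eps -> eps < 1 -> (0 < M)%N -> 8 * (n%:R * n%:R) <= eps * M%:R ->
  holds_solution sw s n f g ->
  runs (phase sw) s (n.+1 * (2000 * (n.+1 * M.+1) + 20)) (fun s' =>
    [/\ holds_solution sw s' n f g, rmem s' rbest 0 <= rmem s rbest 0 &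
        forall p, (p < n)%N -> covers n f g p eps (rmem s' rbest 0)]).
Proof.
move=> hn hM hW hf hg f0 g0 e0 e1 M0 heps hsol.
apply: (@runs_for _ _ _ _ _ n _ (fun j s' =>
    [/\ holds_solution sw s' n f g, rmem s' rbest 0 <= rmem s rbest 0 &
        forall p, (p < j)%N -> covers n f g p eps (rmem s' rbest 0)])) => //;
  try by case: (sw).
  by split=> //; move: hsol; rewrite /holds_solution; case: (sw).
move=> p s1 hp [fn fr] hvp [q1 q2 q3].
apply: (runs_weaken (@guess_spec sw s1 n M p f g eps _ _ _ hvp hp _ _ f0 g0 e0 e1
  M0 heps q1)) => //; try by [rewrite fn //; case: (sw)
  |move=> i; rewrite fr ?hf ?hg //; case: (sw)].
move=> s2 [p1 p2 p3]; split.
- by move: p1; rewrite /holds_solution; case: (sw).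
- exact: le_trans q2.
move=> j /=; rewrite ltnS leq_eqVlt => /orP[/eqP -> //|hj] t h1 h2 h3 h4.
exact: le_trans p2 (q3 _ hj t h1 h2 h3 h4).
Qed.

(** * Choosing the scale and the first solution *)

Lemma find_M_spec s n (eps : R) (N := Num.truncn (8 * (n%:R * n%:R) / eps)) :
  nmem s vn 0 = n -> rmem s reps 0 = eps -> 0 < eps ->
  runs find_M s (3 + (N * 25 + 19)) (fun s' => exists M,
    [/\ nmem s' vM 0 = M, (0 < M)%N, (M <= N.+1)%N &
        8 * (n%:R * n%:R) <= eps * M%:R]).
Proof.
move=> hn he e0; set q := 8 * (n%:R * n%:R) in N *.
have q0 : 0 <= q / eps by rewrite divr_ge0 ?mulr_ge0 ?ler0n // ltW.
pose I k s' := exists m, [/\ (m + k = N.+1)%N, nmem s' vM 0 = m, (0 < m)%N,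
  nmem s' vn 0 = n & rmem s' reps 0 = eps].
apply: runs_seq; apply: runs_step => //.
apply: runs_weaken.
- apply: (@runs_while _ _ _ I N 6).
    by exists 1%N.
  move=> k s1 [m [hm h1 h2 h3 h4]] /=; rewrite h1 h3 h4 -/q -ltNge => hlt.
  (* While the guard holds, [m < q / eps], so [m] is at most the integer part [N]; the search
     therefore ends by [N.+1]. *)
  have hmN : (m <= N)%N.
    by rewrite truncn_ge_nat // ler_pdivlMr // mulrC ltW.
  split; first by clear -hm hmN; lia.
  apply: runs_step => //=; exists m.+1; rewrite /upd /= h1 addn1; split=> //.
  by clear -hm hmN; lia.
- by [].
move=> s1 [/= hg [k [m [hm h1 h2 h3 h4]]]]; exists m; split=> //.
  by clear -hm; lia.
by move: hg; rewrite h1 h3 h4 negbK.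
Qed.

Lemma memsum_single (o : nat -> nat) j (F : nat -> R) n :
  (j < n)%N -> (forall i, o i = (i == j)) -> memsum o F n = F j.
Proof.
move=> hj ho; rewrite /memsum (bigD1 (Ordinal hj)) //= ho eqxx /=.
rewrite big1 ?addr0 // => i hi; rewrite ho.
suff /negPf -> : (i : nat) != j by [].
by apply: contra hi => /eqP h; apply/eqP/val_inj.
Qed.

Lemma setup_spec s n M (f g : nat -> R) :
  (forall x i, x != vn -> x != vM -> nmem s x i = 0%N) ->
  nmem s vM 0 = M -> (1 < n)%N ->
  (forall i, rmem s 0 i = f i) -> (forall i, rmem s 1 i = g i) ->
  (forall i, (i < n)%N -> 0 < f i) -> (forall i, (i < n)%N -> 0 < g i) ->
  runs setup s 100 (fun s' => nmem s' vW 0 = M.*2.+1 /\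
    holds_solution false s' n f g).
Proof.
move=> h0 hM hn hf hg f0 g0.
apply: (@runs_weaken _ _ _ (max_cost setup) _ _ _ _ _ (fun s' h => h)) => //.
apply: runs_step => //.
have h01 : (0 < n)%N by apply: ltnW.
suff [e1 e2 e3 e4] : [/\ nmem (step setup s) vW 0 = M.*2.+1,
    forall i, nmem (step setup s) 1 i = (i == 0%N),
    forall i, nmem (step setup s) 2 i = (i == 1%N) &
    rmem (step setup s) rbest 0 = ratio2 (f 0%N) (g 1%N)].
  split=> //; rewrite /holds_solution /solution /outL /outS.
  rewrite (memsum_single _ h01 e2) (memsum_single _ hn e3); split=> //.
  - by move=> i _; rewrite e2 e3; case: i => [|i]; [right|left].
  - exact: f0.
  - exact: g0.
rewrite ratio2E /= hM hf hg; case: ifP => _; split=> //= *;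
  rewrite /upd /= ?addn1 ?addnn // h0 //; by case: (_ == _).
Qed.

(** * From labelings to optimal pairs of sets *)

Lemma solution_sym n (f g : nat -> R) oL oS best :
  solution n f g oL oS best -> solution n g f oS oL best.
Proof.
move=> [h1 h2 h3 h4]; split=> //; last by rewrite ratio2C.
by move=> i /h1 [h|h]; [right|left].
Qed.

(** Among all guesses, the one that succeeds is an index of a largest element of [T1]; it exists
    because [T1] is nonempty. *)
Lemma covers_sets n (F G : 'I_n -> R) (f g : nat -> R) T1 T2 eps best :
  (forall i, f (val i) = F i) -> (forall i, g (val i) = G i) ->
  (forall i, 0 < G i) -> feasible T1 T2 ->
  \sum_(i in T2) G i <= \sum_(i in T1) F i ->
  (forall p, (p < n)%N -> covers n f g p eps best) ->
  best <= (1 + eps) * ((\sum_(i in T1) F i) / (\sum_(i in T2) G i)).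
Proof.
move=> eF eG G0 [/set0Pn[i1 hi1] /set0Pn[i2 hi2] dis] hle hcov.
pose t i : nat := if insub i is Some j then
  (if j \in T1 then 1%N else if j \in T2 then 2%N else 0%N) else 0%N.
have tE (j : 'I_n) : t j = if j \in T1 then 1%N else if j \in T2 then 2%N else 0%N.
  by rewrite /t valK.
have s1 : selsum t 1 f n = \sum_(i in T1) F i.
  rewrite [RHS]big_mkcond; apply: eq_bigr => i _; rewrite tE eF.
  by case: (i \in T1) => //; case: (i \in T2).
have s2 : selsum t 2 g n = \sum_(i in T2) G i.
  rewrite [RHS]big_mkcond; apply: eq_bigr => i _; rewrite tE eG.
  case: (boolP (i \in T1)) => [hi|_]; last by case: (i \in T2).
  by rewrite (disjointFr dis hi).
have [p hp hmax] := arg_maxP F hi1.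
rewrite -s1 -s2; apply: (hcov p (ltn_ord p) t).
- move=> i hi; rewrite (tE (Ordinal hi)) !eF -[i]/(val (Ordinal hi)) eF.
  by case: ifP => [/hmax //|_]; case: ifP.
- by rewrite tE (hp : p \in T1).
- by rewrite s2 (bigD1 i2) //= ltr_wpDr // sumr_ge0 // => i _; rewrite ltW.
- by rewrite s1 s2.
Qed.

(** There are finitely many pairs of sets, and two distinct singletons form a feasible one. *)
Lemma optimal_exists n (a b : 'I_n -> R) :
  (1 < n)%N -> exists T1 T2, optimal a b T1 T2.
Proof.
move=> hn; pose i0 : 'I_n := Ordinal (ltnW hn); pose i1 : 'I_n := Ordinal hn.
pose feas (T : {set 'I_n} * {set 'I_n}) :=
  [&& T.1 != set0, T.2 != set0 & [disjoint T.1 & T.2]].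
have h0 : feas ([set i0], [set i1]).
  rewrite /feas /= -!cards_eq0 !cards1 /= disjoints1 inE; exact: isT.
have [[T1 T2] /and3P[/= h1 h2 h3] hmin] :=
  arg_minP (fun T => ssr_ratio a b T.1 T.2) h0.
exists T1, T2; split=> // S1 S2 [g1 g2 g3].
by apply: (hmin (S1, S2)); rewrite /feas /= g1 g2.
Qed.

Lemma memsum_output (k n : nat) s (F : 'I_n -> R) (f : nat -> R) :
  (forall i, f (val i) = F i) ->
  \sum_(i in output n k s) F i = memsum (nmem s k) f n.
Proof.
by move=> eF; rewrite big_mkcond; apply: eq_bigr => i _; rewrite inE eF.
Qed.

Lemma sum_gt0_nonempty n (F : 'I_n -> R) (T : {set 'I_n}) :
  0 < \sum_(i in T) F i -> T != set0.
Proof. by apply: contraTneq => ->; rewrite big_set0 ltxx. Qed.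

End Correctness.

(** * Approximation guarantee and running time of the whole program *)

Theorem theorem4 (R : realType) :
  exists (prog : com) (C : R),
    forall (n : nat) (a b : 'I_n -> R) (eps : R),
      (2 <= n)%N ->
      (forall i, 0 < a i) -> (forall i, 0 < b i) ->
      0 < eps -> eps < 1 ->
      exists (t : nat) (s : state R),
        [/\ exec prog (input a b eps) t s,
            t%:R <= C * (n%:R ^+ 4 / eps),
            feasible (output n 1 s) (output n 2 s)
          & exists T1 T2 : {set 'I_n},
              optimal a b T1 T2 /\
              ssr_ratio a b (output n 1 s) (output n 2 s)
                <= (1 + eps) * ssr_ratio a b T1 T2].
Proof.
(* The time is at most [5000 (n + 1)^2 (N + 2)]; with [n + 1 <= 2 n] and [N + 2 <= 10 n^2 / eps]
   this gives the constant [5000 * 4 * 10]. *)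
exists prog, 200000%:R => n a b eps hn a0 b0 e0 e1.
set s0 := input a b eps; pose f := rmem s0 0%N; pose g := rmem s0 1%N.
have ef i : f (val i) = a i by rewrite /f /= valK.
have eg i : g (val i) = b i by rewrite /g /= valK.
have f0 i : (i < n)%N -> 0 < f i by move=> hi; rewrite (ef (Ordinal hi)).
have g0 i : (i < n)%N -> 0 < g i by move=> hi; rewrite (eg (Ordinal hi)).
pose N := Num.truncn (8 * (n%:R * n%:R) / eps).
have [t [s [hex ht]]] : runs prog s0 (5000 * (n.+1 * n.+1 * N.+2)) (fun s =>
    [/\ holds_solution false s n f g,
      forall p, (p < n)%N -> covers n f g p eps (rmem s rbest 0) &
      forall p, (p < n)%N -> covers n g f p eps (rmem s rbest 0)]).
  apply: (@runs_weaken _ _ _ (3 + (N * 25 + 19) + (100 +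
    (n.+1 * (2000 * (n.+1 * N.+2) + 20) + n.+1 * (2000 * (n.+1 * N.+2) + 20))))%N
    _ _ _ _ _ (fun s' h => h)); last by clear; nia.
  apply: runs_seq.
  apply: (runs_weaken (runs_frame (@find_M_spec _ s0 n eps _ _ e0))) => //.
  move=> s1 [[M [hM M0 MN hq]] [fn1 fr1]].
  have hT : (n.+1 * (2000 * (n.+1 * M.+1) + 20) <=
     n.+1 * (2000 * (n.+1 * N.+2) + 20))%N.
    by rewrite leq_mul2l leq_add2r !leq_mul2l ltnS MN !orbT.
  apply: runs_seq.
  apply: (runs_weaken (runs_frame (@setup_spec _ s1 n M f g _ hM hn _ _ f0 g0)))
    => //; try by move=> i; rewrite fr1.
    by move=> x i hx1 hx2; rewrite fn1 ?inE ?negb_or ?hx2 //= (negPf hx1).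
  move=> s2 [[hW hsol] [fn2 fr2]].
  apply: runs_seq.
  apply: (runs_weaken (runs_frame (@phase_spec _ false s2 n M f g eps
    _ _ hW _ _ f0 g0 e0 e1 M0 hq hsol))) => //.
  - by rewrite fn2 // fn1.
  - by rewrite fn2.
  - by move=> i; rewrite fr2 // fr1.
  - by move=> i; rewrite fr2 // fr1.
  move=> s3 [[hsol3 _ hc3] [fn3 fr3]].
  (* The second phase exchanges the roles of the [a_i] and the [b_i] but keeps the output arrays, so
     the stored solution carries over by symmetry. *)
  apply: (runs_weaken (@phase_spec _ true s3 n M g f eps
    _ _ _ _ _ g0 f0 e0 e1 M0 hq (solution_sym hsol3))) => //.
  - by rewrite fn3 // fn2 // fn1.
  - by rewrite fn3 // fn2.
  - by rewrite fn3.
  - by move=> i; rewrite fr3 // fr2 // fr1.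
  - by move=> i; rewrite fr3 // fr2 // fr1.
  move=> s4 [hsol4 hle4 hc4]; split=> //; first exact: solution_sym hsol4.
  move=> p hp u h1 h2 h3 h4; exact: le_trans hle4 (hc3 p hp u h1 h2 h3 h4).
move=> [[dis x0 y0 hbest] hc1 hc2]; exists t, s.
have sL : \sum_(i in output n 1 s) a i = memsum (nmem s 1) f n.
  exact: memsum_output.
have sS : \sum_(i in output n 2 s) b i = memsum (nmem s 2) g n.
  exact: memsum_output.
split=> //.
- apply: (@le_trans _ _ (5000 * (n.+1 * n.+1 * N.+2))%:R); first by rewrite ler_nat.
  have n1 : 1 <= n%:R :> R by rewrite ler1n ltnW.
  have hN : N%:R <= 8 * (n%:R * n%:R) / eps :> R.
    by rewrite truncn_le divr_ge0 ?mulr_ge0 ?ler0n // ltW.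
  have hne : 1 <= n%:R * n%:R / eps.
    by rewrite ler_pdivlMr // mul1r; nra.
  rewrite !natrM -[N.+2]addn2 -[n.+1]addn1 !natrD.
  have -> : 200000%:R * (n%:R ^+ 4 / eps) =
    5000%:R * ((2 * n%:R) * (2 * n%:R) * (10 * (n%:R * n%:R / eps))) :> R.
    by field; rewrite gt_eqF.
  rewrite ler_pM2l ?ltr0n // ler_pM //; first by apply: mulr_ge0; lra.
  + by apply: addr_ge0; rewrite ler0n.
  + by rewrite ler_pM //; lra.
  + rewrite -mulrA in hN; lra.
- split.
  + by apply: (@sum_gt0_nonempty _ _ a); rewrite sL.
  + by apply: (@sum_gt0_nonempty _ _ b); rewrite sS.
  + apply/pred0P=> i /=; rewrite !inE.
    by case: (dis i (ltn_ord i)) => /= ->; rewrite ?andbF.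
have [T1 [T2 hopt]] := optimal_exists a b hn.
exists T1, T2; split=> //; have [feas _] := hopt.
rewrite {1}/ssr_ratio sL sS -/(ratio2 _ _) -hbest.
rewrite -[ssr_ratio _ _ _ _]/(ratio2 _ _).
(* The side of the optimal pair with the larger sum decides which of the two phases gives the
   bound. *)
case: (leP (\sum_(j in T2) b j) (\sum_(i in T1) a i)) => h.
  rewrite ratio2C ratio2E h; exact: covers_sets hc1.
rewrite ratio2E (ltW h); apply: covers_sets hc2 => //; last exact: ltW.
by case: feas => h1 h2 h3; split=> //; rewrite disjoint_sym.
Qed.
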